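(* Let $a,b,c$ be vertices of $\mathbb{Z}^2$ with $b\neq c$, and consider the rotor walk associated with simple random walk on $\mathbb{Z}^2$, with the anticlockwise rotor mechanism and the specific initial rotor configuration $r$ described in the context, all modified so that $p(b,a)=p(c,a)=1$ (with the vertex $a$ split if $a\in\{b,c\}$), started at vertex $a$. Let $h(a)=h_{b,c}(a)=\mathbb{P}_a(T_b<T_c)$. Then there are finite constants $C,C'$ depending on $a,b,c$ such that for any $t$, with $n=n_t(b)+n_t(c)$, $$\left| h(a)-\frac{n_t(b)}{n}\right|\leq \frac{C\ln n}{n}.$$ Furthermore, $t\leq C' n^3$.
   Context: Unmodified walk: $V=\mathbb{Z}^2$, $p(u,v)=1/4$ if $\|u-v\|_1=1$ and $p(u,v)=0$ otherwise (simple symmetric random walk). Rotor mechanism: for each $u\in\mathbb{Z}^2$, $d(u)=4$ and the successors of $u$ are $u^{(i)}=u+(\cos\frac{i\pi}{2},\sin\frac{i\pi}{2})$, $i=1,\ldots,4$. Initial rotor configuration: $$r((x,y)):=\Big\lfloor \tfrac12+\tfrac{2}{\pi}\arg(x-\tfrac12,y-\tfrac12)\Big\rfloor \bmod 4,$$ where $\arg(x,y)\in[0,2\pi)$ is the angle $\theta$ such that $(x,y)=\rho(\cos\theta,\sin\theta)$ with $\rho>0$, and the residue mod $4$ is taken in $\{1,2,3,4\}$. Modification: if $a\notin\{b,c\}$, set $p(b,a)=p(c,a)=1$, $d(b)=d(c)=1$, $b^{(1)}=c^{(1)}=a$, and let the (only possible) rotor values at $b$ and $c$ be $1$. If $a=b$,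 first split this vertex into two distinct vertices, $a$ and $b$: $b$ inherits all the incoming transitions (every successor, of any vertex, equal to the original site is replaced by $b$), and $a$ inherits the outgoing transitions (the successors $u^{(1)},\ldots,u^{(4)}$ and the initial rotor value of the original site); then make the modification $p(b,a)=p(c,a)=1$, $d(b)=d(c)=1$, $b^{(1)}=c^{(1)}=a$ with the new vertices. Similarly if $a=c$. Rotor walk: given $x_0=a$ and the initial rotor configuration $r_0$ (that is, $r$ as modified), define inductively: $r_{t+1}(v)=r_t(v)$ for $v\ne x_t$; $r_{t+1}(x_t)=r_t(x_t)+1$ if $r_t(x_t)<d(x_t)$ and $r_{t+1}(x_t)=1$ if $r_t(x_t)=d(x_t)$; and $x_{t+1}:=(x_t)^{(r_{t+1}(x_t))}$. $n_t(v):=\#\{s\in\{0,\ldots,t-1\}: x_s=v\}$ is the number of visits to $v$ before time $t$. $\mathbb{P}_a$ is the law of the (modified) Markov chain $(X_t)$ started at $a$, and $T_v:=\min\{t\ge0:X_t=v\}$ with $\min\emptyset:=\infty$.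
   Formalization: The first bound is stated for n ≥ 2 (at n = 0 it is undefined; at n = 1 the right side is 0 while 0 < h(a) < 1 and n_t(b)/n is 0 or 1, so it is false), and t ≤ C'n³ is stated for n ≥ 1 (it fails at t = 1, n = 0). *)

(* Defs.v *)
From HB Require Import structures.
From mathcomp Require Import all_boot all_order all_algebra.
From mathcomp Require Import all_classical all_reals all_analysis.

Set Implicit Arguments.
Unset Strict Implicit.
Unset Printing Implicit Defensive.

Import Order.TTheory GRing.Theory Num.Theory.

Local Open Scope classical_set_scope.
Local Open Scope ring_scope.

Definition site : Type := (int * int)%type.

Definition rot (u : site) : site := (- u.2, u.1).

(* The unit vector (cos (i pi / 2), sin (i pi / 2)); see [dirE]. *)
Definition dir (i : nat) : site := iter i rot (1, 0).

Lemma dirE (R : realType) (i : nat) :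
  (dir i).1%:~R = cos (i%:R * pi / 2) :> R /\
  (dir i).2%:~R = sin (i%:R * pi / 2) :> R.
Proof.
elim: i => [|i [IHc IHs]]; first by rewrite !mul0r cos0 sin0.
have -> : i.+1%:R * pi / 2 = i%:R * pi / 2 + pi / 2 :> R.
  by rewrite -natr1 mulrDl mul1r mulrDl.
by rewrite cosDpihalf sinDpihalf -IHc -IHs /= rmorphN.
Qed.

Definition dist1 (u v : site) : int := `|u.1 - v.1| + `|u.2 - v.2|.

Definition arg (R : realType) (x y : R) : R :=
  xget 0 [set th : R | 0 <= th < 2 * pi /\
    exists2 rho : R, 0 < rho & x = rho * cos th /\ y = rho * sin th].

(* The residue modulo 4 in {1, 2, 3, 4}. *)
Definition residue4 (z : int) : nat := `|((z - 1) %% 4)%Z|%N.+1.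

Definition rotor_init (R : realType) (u : site) : nat :=
  residue4 (Num.floor
    (1 / 2 + 2 / pi * arg (u.1%:~R - 1 / 2) (u.2%:~R - 1 / 2) : R)).

(* Vertices of the modified graph: [Some u] is the site u, and [None] is the
   new copy of a created by the splitting when a is b or c. In that case
   [Some a] keeps the incoming transitions (it is the vertex b or c), while
   [None] gets the outgoing ones and plays the role of a. When no splitting
   takes place, [None] is a spare vertex: no transition leads to it and it is
   never visited from [start]. *)
Definition vertex : Type := option site.

Section Modified.
Variables a b c : site.

Definition start : vertex := if (a == b) || (a == c) then None else Some a.

Definition returning (v : vertex) : bool := (v == Some b) || (v == Some c).

(* Away from the vertices b and c, v has the outgoing transitions and the
   initial rotor of the site [origin v]; in particular [None] has those of a. *)
Definition origin (v : vertex) : site := odflt a v.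

Definition trans (R : realType) (v w : vertex) : R :=
  if returning v then (w == start)%:R
  else if w is Some u then (if dist1 (origin v) u == 1 then 1 / 4 else 0)
  else 0.

Definition deg (v : vertex) : nat := if returning v then 1%N else 4%N.

Definition successor (v : vertex) (i : nat) : vertex :=
  if returning v then start else Some (origin v + dir i).

Definition rotor0 (R : realType) (v : vertex) : nat :=
  if returning v then 1%N else rotor_init R (origin v).

Definition rotor_step (xr : vertex * (vertex -> nat)) :
    vertex * (vertex -> nat) :=
  let: (x, r) := xr in
  let i := if (r x < deg x)%N then (r x).+1 else 1%N in
  (successor x i, fun v => if v == x then i else r v).

Definition rotor_walk (R : realType) (t : nat) : vertex :=
  (iter t rotor_step (start, rotor0 R)).1.

Definition visits (R : realType) (t : nat) (v : site) : nat :=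
  #|[pred s : 'I_t | rotor_walk R s == Some v]|.

End Modified.

(* The law of X is that of the Markov chain with transitions p started at x0;
   the last clause is the Markov property P(X_{t+1} = v_{t+1} | X_s = v_s for
   s <= t) = p(v_t, v_{t+1}), multiplied out to allow null conditioning
   events. *)
Definition is_markov_chain (R : realType) (d : measure_display)
    (T : measurableType d) (P : probability T R) (V : Type) (p : V -> V -> R)
    (x0 : V) (X : nat -> T -> V) : Prop :=
  [/\ forall t v, measurable [set w | X t w = v],
      P [set w | X 0%N w = x0] = 1%E &
      forall (t : nat) (v : nat -> V),
        P [set w | forall s, (s <= t.+1)%N -> X s w = v s] =
        (P [set w | forall s, (s <= t)%N -> X s w = v s] *
          (p (v t) (v t.+1))%:E)%E].

(* First hitting time of v, equal to +oo if v is never visited. *)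
Definition hitting_time (R : realType) (T V : Type) (X : nat -> T -> V) (v : V)
    (w : T) : \bar R :=
  ereal_inf [set (t%:R)%:E | t in [set t : nat | X t w = v]].

(* P(T_b < T_c). *)
Definition hit_before (R : realType) (d : measure_display)
    (T : measurableType d) (P : probability T R) (V : Type) (X : nat -> T -> V)
    (b c : V) : R :=
  fine (P [set w | (hitting_time R X b w < hitting_time R X c w)%E]).

(* Main.v *)
(* Let h be the probability of hitting b before c. Each departure of the rotor
   walk from a site u uses the four directions in turn and h is harmonic, so the
   total increment of h over these departures is bounded by the gradient of h
   at u, however many they are. As each passage from b or c back to a changes h
   by h(a) - 1 or h(a), summing all increments of h up to time t gives
   |n h(a) - n_t(b)| <= const + 2 sum |grad h|, the sum being over the sites
   visited before t.

   The initial rotors make the walk turn around each new square annulus, and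
   comparing the departures from a site with those from its neighbours shows
   that each departure from a opens at most one new annulus and uses a site at
   most four times. As a is left at most C (n + 1) times, the visited sites lie
   in a box of radius O(n), and t = O(n^3).

   It remains to bound the sum of |grad h| over a box of radius r by C ln r. Up
   to constants h(u) = A(u - c) - A(u - b), with A the potential kernel, so that
   grad h is a sum of second differences of p_m, the law of simple random walk
   at time m. By duality their sum over the box is controlled by
   |grad grad P^m F| for |F| <= 1 supported in the box, where P is the averaging
   operator. Since P(f^2) - (P f)^2 dominates |grad f|^2, one has
   |grad P^m f| <= C sup |f| / sqrt m, hence a bound C / m for every m, which
   improves to C r^2 / m^2 because p_m <= C / m. Finally A tends to infinity,
   which by the maximum principle identifies h(a) with P_a(T_b < T_c). *)

Require Import Defs.
From HB Require Import structures.
From mathcomp Require Import all_boot all_order all_algebra.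
From mathcomp Require Import all_classical all_reals all_analysis.
From mathcomp Require Import ring lra zify.

Set Implicit Arguments.
Unset Strict Implicit.
Unset Printing Implicit Defensive.

Import Order.TTheory GRing.Theory Num.Theory.
Import numFieldNormedType.Exports.

Local Open Scope classical_set_scope.
Local Open Scope ring_scope.

(** * Smoothing by the averaging operator *)

Section Averaging.
Variable R : realType.
Implicit Types (f g : site -> R) (x u : site) (K : R).

Definition avg f x : R := (\sum_(i < 4) f (x + dir i.+1)) / 4.

(** Increments are taken from the mean rather than from [f x]: they are then centred, as [variance]
    requires, and still commute with [avg]. *)
Definition dev (i : 'I_4) f x : R := f (x + dir i.+1) - avg f x.

Definition translate u f x : R := f (x + u).

Lemma big4 (V : nmodType) (F : 'I_4 -> V) :
  \sum_(i < 4) F i = F ord0 + F 1 + F 2%:R + F ord_max.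
Proof.
rewrite !big_ord_recr big_ord0 /= add0r.
by congr (_ + _ + _ + _); congr F; apply/val_inj.
Qed.

Lemma avg_lin (I : Type) (r : seq I) (a : I -> R) (F : I -> site -> R) :
  avg (fun y => \sum_(j <- r) a j * F j y) = fun x => \sum_(j <- r) a j * avg (F j) x.
Proof.
apply/funext => x; rewrite /avg exchange_big /= mulr_suml.
by apply: eq_bigr => j _; rewrite -mulr_sumr mulrA.
Qed.

Lemma avgD f g : avg (fun y => f y + g y) = fun x => avg f x + avg g x.
Proof. by apply/funext => x; rewrite /avg big_split mulrDl. Qed.

Lemma avgN f : avg (fun y => - f y) = fun x => - avg f x.
Proof. by apply/funext => x; rewrite /avg sumrN mulNr. Qed.

Lemma avgB f g : avg (fun y => f y - g y) = fun x => avg f x - avg g x.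
Proof. by rewrite avgD avgN. Qed.

Lemma avgZ K f : avg (fun y => K * f y) = fun x => K * avg f x.
Proof. by apply/funext => x; rewrite /avg -mulr_sumr mulrA. Qed.

Lemma avg_cst K : avg (fun=> K) = fun=> K.
Proof. by apply/funext => x; rewrite /avg big4; lra. Qed.

Lemma avg_translate u f : avg (translate u f) = translate u (avg f).
Proof.
apply/funext => x; rewrite /avg /translate; congr (_ / _).
by apply: eq_bigr => i _; rewrite addrAC.
Qed.

Lemma avg_le f g x : (forall y, f y <= g y) -> avg f x <= avg g x.
Proof. by move=> fg; rewrite ler_pM2r ?invr_gt0//; apply: ler_sum. Qed.

Lemma devE i f : dev i f = fun x => translate (dir i.+1) f x - avg f x.
Proof. by []. Qed.

Lemma avg_dev i f : avg (dev i f) = dev i (avg f).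
Proof. by rewrite devE avgB avg_translate. Qed.

Lemma iter_avg_dev n i f : iter n avg (dev i f) = dev i (iter n avg f).
Proof. by elim: n => //= n ->; rewrite avg_dev. Qed.

Lemma iter_avg_translate n u f :
  iter n avg (translate u f) = translate u (iter n avg f).
Proof. by elim: n => //= n ->; rewrite avg_translate. Qed.

Lemma iter_avgD n f g :
  iter n avg (fun y => f y + g y) = fun x => iter n avg f x + iter n avg g x.
Proof. by elim: n => //= n ->; rewrite avgD. Qed.

Lemma iter_avgZ n K f :
  iter n avg (fun y => K * f y) = fun x => K * iter n avg f x.
Proof. by elim: n => //= n ->; rewrite avgZ. Qed.

Lemma iter_avg_lin n (I : Type) (r : seq I) (a : I -> R) (F : I -> site -> R) :
  iter n avg (fun y => \sum_(j <- r) a j * F j y) =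
  fun x => \sum_(j <- r) a j * iter n avg (F j) x.
Proof. by elim: n => //= n ->; rewrite avg_lin. Qed.

Lemma iter_avg_le n f g x :
  (forall y, f y <= g y) -> iter n avg f x <= iter n avg g x.
Proof. by elim: n x => //= n IH x fg; apply: avg_le => y; apply: IH. Qed.

(** The mean of the squares exceeds the square of the mean by the mean of the squared deviations;
    only one of the four deviations is kept. *)
Lemma variance i f x : avg f x ^+ 2 + dev i f x ^+ 2 / 4 <= avg (fun y => f y ^+ 2) x.
Proof.
have -> : avg (fun y => f y ^+ 2) x =
    avg f x ^+ 2 + (\sum_(j < 4) dev j f x ^+ 2) / 4.
  by rewrite /dev /avg !big4; lra.
rewrite lerD2l ler_pM2r ?invr_gt0// (bigD1 i)//= lerDl.
by apply: sumr_ge0 => j _; apply: sqr_ge0.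
Qed.

Lemma iter_avg_sqr n i f x :
  iter n.+1 avg f x ^+ 2 + n.+1%:R / 4 * dev i (iter n avg f) x ^+ 2 <=
  iter n.+1 avg (fun y => f y ^+ 2) x.
Proof.
have jensen m g y : iter m avg g y ^+ 2 <= iter m avg (fun y => g y ^+ 2) y.
  elim: m g y => //= m IH g y.
  have h := variance i (iter m avg g) y.
  have h' : avg (fun y => iter m avg g y ^+ 2) y <= avg (iter m avg (fun y => g y ^+ 2)) y.
    by apply: avg_le => z; apply: IH.
  have := sqr_ge0 (dev i (iter m avg g) y); lra.
elim: n f => [|n IH] f; first by have := variance i f x; rewrite /=; lra.
(* [variance] for [f] is averaged [n + 1] more times; the induction hypothesis is used at [avg f],
   and [jensen] compares the averaged square of [dev i f] with the square of its average. *)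
have h1 : iter n.+1 avg (fun y => avg f y ^+ 2 + 4^-1 * dev i f y ^+ 2) x <=
    iter n.+1 avg (avg (fun y => f y ^+ 2)) x.
  by apply: iter_avg_le => y; have := variance i f y; lra.
rewrite (iter_avgD n.+1 (fun y => avg f y ^+ 2)) iter_avgZ in h1.
have h2 := IH (avg f); have h3 := jensen n.+1 (dev i f) x.
rewrite iter_avg_dev in h3.
rewrite -!iterSr in h1 h2.
rewrite -[n.+2%:R]natr1; lra.
Qed.

Definition bdd K f := forall x, `|f x| <= K.

Lemma bdd_translate K u f : bdd K f -> bdd K (translate u f).
Proof. by move=> fK x; apply: fK. Qed.

Lemma bdd_avg K f : bdd K f -> bdd K (avg f).
Proof.
move=> fK x; rewrite ler_norml; apply/andP; split.
  rewrite -[- K]/((fun=> - K) x) -[X in X x <= _]avg_cst.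
  by apply: avg_le => y; have := fK y; rewrite ler_norml => /andP[].
rewrite -[leRHS]/((fun=> K) x) -[X in _ <= X x]avg_cst.
by apply: avg_le => y; have := fK y; rewrite ler_norml => /andP[].
Qed.

Lemma bdd_iter_avg K n f : bdd K f -> bdd K (iter n avg f).
Proof. by move=> fK; elim: n => //= n; apply: bdd_avg. Qed.

Lemma bddD K L f g : bdd K f -> bdd L g -> bdd (K + L) (fun x => f x + g x).
Proof. by move=> fK gL x; apply: (le_trans (ler_normD _ _)); apply: lerD. Qed.

Lemma bddB K L f g : bdd K f -> bdd L g -> bdd (K + L) (fun x => f x - g x).
Proof. by move=> fK gL x; apply: (le_trans (ler_normB _ _)); apply: lerD. Qed.

(* The gradient of [P^n f] decays like [1 / sqrt n]: by [variance], the squared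
   gradients of [P^k f], [k < n], add up to at most [4 K^2] after averaging,
   and by Jensen each of them is at least that of [P^n f]. *)
Lemma bdd_dev K n i f : bdd K f ->
  bdd (2 * K / Num.sqrt n.+1%:R) (dev i (iter n avg f)).
Proof.
move=> fK x; have K0 : 0 <= K by apply: le_trans (fK x).
have s0 : (0 : R) < Num.sqrt n.+1%:R by rewrite sqrtr_gt0.
rewrite ler_pdivlMr// -ler_sqr ?nnegrE; last 2 first.
- by rewrite mulr_ge0// ltW.
- by rewrite mulr_ge0.
rewrite exprMn sqr_sqrtr ?ler0n// real_normK ?num_real//.
have h := iter_avg_sqr n i f x.
have : iter n.+1 avg (fun y => f y ^+ 2) x <= K ^+ 2.
  have : bdd (K ^+ 2) (fun y => f y ^+ 2).
    move=> y; rewrite ger0_norm ?sqr_ge0// -real_normK ?num_real//.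
    by rewrite ler_sqr ?nnegrE.
  by move=> /(bdd_iter_avg n.+1)/(_ x) => h'; apply: le_trans h'; apply: ler_norm.
have := sqr_ge0 (iter n.+1 avg f x); nra.
Qed.

Lemma dirN2 (i : nat) : dir i.+2 = - dir i.
Proof. by rewrite /dir /= /rot /=. Qed.


Lemma dev_dev i j f x : dev i (dev j f) x =
  f (x + dir i.+1 + dir j.+1) - avg f (x + dir i.+1) - avg f (x + dir j.+1) +
  avg (avg f) x.
Proof. by rewrite /dev -/(dev j f) avg_dev /dev; lra. Qed.

(** Directions 1 and 3, and 2 and 4, are opposite, so both double deviations return to [x]. Bounds
    on double deviations thus become bounds on [P^2 - 1]. *)
Lemma avg2E f x :
  avg (avg f) x = f x - (dev ord0 (dev 2%:R f) x + dev 1 (dev ord_max f) x) / 2.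
Proof.
rewrite !dev_dev -[in X in _ - X]addrA /=.
have e1 : x + dir 1 + dir 3 = x by rewrite dirN2 addrK.
have e2 : x + dir 2 + dir 4 = x by rewrite (dirN2 2) addrK.
rewrite /= in e1 e2 *; rewrite e1 e2.
have -> : avg (avg f) x = (avg f (x + dir 1) + avg f (x + dir 2) +
    avg f (x + dir 3) + avg f (x + dir 4)) / 4.
  by rewrite {1}/avg big4.
lra.
Qed.

Definition lapl2 f x := avg (avg f) x - f x.

(* With t_i the translation by [dir i], g' = (1 + P) g and Q_i = t_i - P:
   (t_i - 1)(t_j - 1) g' = (t_i - 1) Q_j g' + (t_i - 1)(P^2 - 1) g and
   (t_i - 1) Q_j g' = Q_i Q_j g' + (P^2 - 1) Q_j g. *)
Lemma second_diffE (i j : 'I_4) g x :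
  let g' := fun y => g y + avg g y in
  g' (x + dir i.+1 + dir j.+1) - g' (x + dir i.+1) - g' (x + dir j.+1) + g' x =
  dev i (dev j g) x + avg (dev i (dev j g)) x + dev j (lapl2 g) x
  + (lapl2 g (x + dir i.+1) - lapl2 g x).
Proof.
move=> g'; rewrite !avg_dev !dev_dev /dev /lapl2 avgB /g'.
have -> : x + dir i.+1 + dir j.+1 = x + dir j.+1 + dir i.+1 by rewrite addrAC.
lra.
Qed.

Lemma first_diffE (j : 'I_4) g x :
  let g' := fun y => g y + avg g y in
  g' (x + dir j.+1) - g' x = dev j g x + avg (dev j g) x + lapl2 g x.
Proof. by move=> g'; rewrite !avg_dev /dev /lapl2 /g'; lra. Qed.

Lemma bdd_dev2 K i f : bdd K f -> bdd (2 * K) (dev i f).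
Proof.
move=> fK; rewrite mulrDl mul1r; apply: (@bddB _ _ (translate (dir i.+1) f)).
  exact: bdd_translate.
exact: bdd_avg.
Qed.

(** Half of the [2 m] averages is spent on each deviation, and each half gains a factor
    [1 / sqrt (m + 1)]. *)
Lemma bdd_dev_dev K m i j f : bdd K f ->
  bdd (4 * K / m.+1%:R) (dev i (dev j (iter (m + m) avg f))).
Proof.
move=> fK; rewrite iterD -iter_avg_dev.
have -> : 4 * K / m.+1%:R = 2 * (2 * K / Num.sqrt m.+1%:R) / Num.sqrt m.+1%:R.
  rewrite -[in LHS](@sqr_sqrtr R m.+1%:R) ?ler0n//.
  have : Num.sqrt m.+1%:R != 0 :> R by rewrite gt_eqF// sqrtr_gt0.
  by move=> ?; field.
by apply: bdd_dev; apply: bdd_dev.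
Qed.

Lemma bdd_lapl2 K m f : bdd K f ->
  bdd (4 * K / m.+1%:R) (lapl2 (iter (m + m) avg f)).
Proof.
move=> fK x; rewrite /lapl2 avg2E.
have h1 := bdd_dev_dev m ord0 2%:R fK x; have h2 := bdd_dev_dev m 1 ord_max fK x.
move: h1 h2; move: (4 * K / _) (dev _ _ x) (dev _ _ x) => B d1 d2.
by rewrite !ler_norml => /andP[? ?] /andP[? ?]; apply/andP; split; lra.
Qed.

(* The pairing of two consecutive powers makes the series over [m] converge:
   [P^n f] alone has a component of alternating sign. *)
Definition avg_pair m f x : R := iter (m + m) avg f x + avg (iter (m + m) avg f) x.

Lemma second_diff_avg_pair K m (i j : 'I_4) f x : bdd K f ->
  `|avg_pair m f (x + dir i.+1 + dir j.+1) - avg_pair m f (x + dir i.+1)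
    - avg_pair m f (x + dir j.+1) + avg_pair m f x| <= 24 * K / m.+1%:R.
Proof.
move=> fK; rewrite second_diffE.
have d := bdd_dev_dev m i j fK; have l := bdd_lapl2 m fK.
(* In units of [K / (m + 1)]: 4 + 4 for the double deviation and its average, 8 for [dev j] of
   [lapl2], 4 + 4 for the increment of [lapl2]. *)
have /(_ x) := bddD (bddD (bddD d (bdd_avg d)) (bdd_dev2 j l))
  (bddB (bdd_translate (dir i.+1) l) l).
by move=> /le_trans; apply; rewrite -!mulrA; move: (K / _) => B; lra.
Qed.

Lemma first_diff_avg_pair K m (j : 'I_4) f x : bdd K f ->
  `|avg_pair m f (x + dir j.+1) - avg_pair m f x| <= 8 * K / Num.sqrt m.+1%:R.
Proof.
move=> fK; rewrite first_diffE.
have K0 : 0 <= K by apply: le_trans (fK 0).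
have d : bdd (2 * K / Num.sqrt m.+1%:R) (dev j (iter (m + m) avg f)).
  by rewrite iterD; apply: bdd_dev; apply: bdd_iter_avg.
have l := bdd_lapl2 m fK.
have /(_ x) := bddD (bddD d (bdd_avg d)) l.
move=> /le_trans; apply.
have s1 : 1 <= Num.sqrt m.+1%:R :> R by rewrite -[X in X <= _]sqrtr1 ler_sqrt ?ler1n.
have : 4 * K / m.+1%:R <= 4 * K / Num.sqrt m.+1%:R.
  rewrite ler_wpM2l ?mulr_ge0// lef_pV2 ?posrE ?ltr0n// ?(lt_le_trans ltr01)//.
  by rewrite -[leRHS](@sqr_sqrtr R) ?ler0n// expr2 ler_peMl// (le_trans ler01).
by rewrite -!mulrA; move: (K / m.+1%:R) (K / Num.sqrt _) => B B1 ?; lra.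
Qed.

(* [binwalk n k] is [2^-n 'C(n, (n + k) / 2)]. In the coordinates x + y, x - y a
   step of the walk on Z^2 consists of two independent steps of +-1. *)
Fixpoint binwalk n (k : int) : R :=
  if n is n'.+1 then (binwalk n' (k - 1) + binwalk n' (k + 1)) / 2
  else (k == 0)%:R.

Definition delta u x : R := (x == u)%:R.

Lemma iter_avg_delta n x :
  iter n avg (delta 0) x = binwalk n (x.1 + x.2) * binwalk n (x.1 - x.2).
Proof.
elim: n x => [|n IH] [x y] /=.
  rewrite -natrM mulnb /delta; congr (_%:R : R); congr nat_of_bool.
  by rewrite xpair_eqE; lia.
have -> : iter n avg (delta 0) =
    fun x => binwalk n (x.1 + x.2) * binwalk n (x.1 - x.2) by apply/funext.
rewrite /avg big4 /=.
have E (u v : int) : u = v -> binwalk n u = binwalk n v by move->.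
rewrite (E (x + 0 + (y + 1)) (x + y + 1)); last by lia.
rewrite (E (x + 0 - (y + 1)) (x - y - 1)); last by lia.
rewrite (E (x + - 1 + (y + 0)) (x + y - 1)); last by lia.
rewrite (E (x + - 1 - (y + 0)) (x - y - 1)); last by lia.
rewrite (E (x - 0 + (y - 1)) (x + y - 1)); last by lia.
rewrite (E (x - 0 - (y - 1)) (x - y + 1)); last by lia.
rewrite (E (x - - 1 + (y - 0)) (x + y + 1)); last by lia.
rewrite (E (x - - 1 - (y - 0)) (x - y + 1)); last by lia.
by lra.
Qed.

Lemma binwalk_ge0 n k : 0 <= binwalk n k.
Proof. by elim: n k => //= n IH k; rewrite divr_ge0// addr_ge0. Qed.

Lemma binwalkN n k : binwalk n (- k) = binwalk n k.
Proof.
elim: n k => [|n IH] k /=; first by rewrite oppr_eq0.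
by rewrite -[binwalk n (- k - 1)]IH -[binwalk n (- k + 1)]IH !opprD !opprK addrC.
Qed.

Lemma binwalk_unimodal n (k : int) : 0 <= k -> binwalk n (k + 2) <= binwalk n k.
Proof.
elim: n k => [|n IH] k k0 /=.
  by rewrite ler_nat; lia.
rewrite ler_pM2r ?invr_gt0//.
have -> : k + 2 - 1 = k + 1 by lia.
rewrite addrC lerD2r.
have -> : k + 2 + 1 = k + 1 + 2 by lia.
(* It remains to compare [k + 3] with [k - 1]: two uses of the induction hypothesis, or a single one
   after reflecting -1 to 1 when [k = 0]. *)
case: (eqVneq k 0) => [->|kn0].
  by rewrite add0r -[leRHS]binwalkN opprD opprK add0r; apply: IH.
have := IH (k - 1); have := IH (k + 1).
have -> : k - 1 + 2 = k + 1 by lia.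
move=> h1 h2; apply: le_trans (h2 _); last by lia.
by apply: h1; lia.
Qed.

Lemma binwalk_parity n (k : int) : odd (n + `|k|) -> binwalk n k = 0.
Proof.
elim: n k => [|n IH] k /= h; first by have -> : (k == 0) = false by lia.
by rewrite !IH ?addr0 ?mul0r//; lia.
Qed.

Lemma binwalk_far n (k : int) : (n < `|k|)%N -> binwalk n k = 0.
Proof.
elim: n k => [|n IH] k /= h; first by have -> : (k == 0) = false by lia.
by rewrite !IH ?addr0 ?mul0r//; lia.
Qed.

Lemma binwalk_max m k : binwalk (m + m) k <= binwalk (m + m) 0.
Proof.
have pos (j : nat) : binwalk (m + m) j%:Z <= binwalk (m + m) 0.
  elim/ltn_ind: j => -[|[|j]] IH //.
    by rewrite binwalk_parity ?binwalk_ge0//; lia.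
  apply: le_trans (IH j _) => //.
  rewrite (_ : j.+2%:Z = j%:Z + 2); last by lia.
  exact: binwalk_unimodal.
by case: (intP k) => [|j|j]; rewrite ?binwalkN.
Qed.

(** This is [j 'C(n, j) = (n - j + 1) 'C(n, j - 1)] with [2 j = n + k + 1]. *)
Lemma binwalk_ratio n (k : int) :
  (n%:R + k%:~R + 1) * binwalk n (k + 1) = (n%:R - k%:~R + 1) * binwalk n (k - 1).
Proof.
elim: n k => [|n IH] k /=.
  case: (eqVneq k 1) => [->|k1]; first by rewrite /=; lra.
  case: (eqVneq k (-1)) => [->|k2]; first by rewrite /= rmorphN /=; lra.
  have -> : (k + 1 == 0) = false by lia.
  have -> : (k - 1 == 0) = false by lia.
  by rewrite !mulr0.
have h1 := IH (k + 1); have h2 := IH (k - 1).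
move: h1 h2; rewrite !rmorphD /= !rmorphN /= addrK subrK -natr1.
rewrite (_ : k + 1 + 1 = k + (1 + 1)) ?addrA// => h1 h2.
lra.
Qed.

Lemma binwalk_central m :
  binwalk (m.+1 + m.+1) 0 = binwalk (m + m) 0 * (m%:R + m%:R + 1) / (m%:R + m%:R + 2).
Proof.
rewrite addSn addnS /= (_ : 0 - 1 - 1 = - (1 + 1))// binwalkN.
rewrite (_ : 0 - 1 + 1 = 0)// (_ : 0 + 1 - 1 = 0)// add0r.
have := binwalk_ratio (m + m) 1; rewrite subrr natrD.
have m0 : 0 <= m%:R :> R by [].
set a := binwalk _ (1 + 1); set b := binwalk _ 0 => h.
have -> : a = (m%:R + m%:R) * b / (m%:R + m%:R + 2).
  by apply: (@mulIf R (m%:R + m%:R + 2)); [lra|rewrite divfK; lra].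
by field; lra.
Qed.

(** By [binwalk_central] the left-hand side decreases in [m], from 1 at [m = 0]. The square is the
    return probability on Z^2 at time [2 m]. *)
Lemma binwalk_central_le m : (m%:R + m%:R + 1) * binwalk (m + m) 0 ^+ 2 <= 1.
Proof.
elim: m => [|m IH]; first by rewrite /=; lra.
rewrite binwalk_central -natr1.
have m0 : 0 <= m%:R :> R by [].
move: IH m0; set a := binwalk _ 0; move: (m%:R : R) => x IH x0.
apply: le_trans IH.
have -> : (x + 1 + (x + 1) + 1) * (a * (x + x + 1) / (x + x + 2)) ^+ 2 =
   ((x + x + 1) * a ^+ 2) * (((x + x + 3) * (x + x + 1)) / (x + x + 2) ^+ 2).
  by field; lra.
rewrite ler_piMr//; first by rewrite mulr_ge0 ?sqr_ge0//; lra.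
by rewrite ler_pdivrMr; nra.
Qed.

(** Here the right-hand side increases in [m]. This lower bound makes the kernel diverge in
    [potential_infty]. *)
Lemma binwalk_central_ge m : 1 <= 4 * m.+1%:R * binwalk (m.+1 + m.+1) 0 ^+ 2.
Proof.
elim: m => [|m IH]; first by rewrite /=; lra.
apply: (le_trans IH); rewrite (binwalk_central m.+1) -[m.+2%:R]natr1.
have m0 : 1 <= m.+1%:R :> R by rewrite ler1n.
move: m0; set a := binwalk _ 0; move: (m.+1%:R : R) => x x0.
have -> : 4 * (x + 1) * (a * (x + x + 1) / (x + x + 2)) ^+ 2 =
   (4 * x * a ^+ 2) * ((x + x + 1) ^+ 2 / (4 * x * (x + 1))).
  by field; lra.
rewrite ler_peMr//; first by rewrite mulr_ge0 ?sqr_ge0//; lra.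
by rewrite ler_pdivlMr; nra.
Qed.

End Averaging.

(** * The potential kernel *)

Lemma site_ind (P : site -> Prop) :
  P 0 -> (forall x (i : 'I_4), P x -> P (x + dir i.+1)) -> forall x, P x.
Proof.
move=> P0 PS.
have step (x v : site) : (exists i : 'I_4, v = dir i.+1) -> P x -> P (x + v).
  by case=> i ->; apply: PS.
have E : exists i : 'I_4, ((1, 0) : site) = dir i.+1 by exists ord_max.
have W : exists i : 'I_4, ((-1, 0) : site) = dir i.+1 by exists 1.
have N : exists i : 'I_4, ((0, 1) : site) = dir i.+1 by exists ord0.
have S : exists i : 'I_4, ((0, -1) : site) = dir i.+1 by exists 2%:R.
have addE (p q r s : int) : ((p, q) : site) + (r, s) = (p + r, q + s) by [].
case=> m n; elim: m => [|m IH|m IH].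
- elim: n => [|n IH|n IH] //.
  + by have := step _ _ N IH; rewrite addE addr0 (_ : n%:Z + 1 = n.+1)//; lia.
  + by have := step _ _ S IH; rewrite addE addr0 (_ : - n%:Z - 1 = - n.+1%:Z)//; lia.
- by have := step _ _ E IH; rewrite addE addr0 (_ : m%:Z + 1 = m.+1)//; lia.
- by have := step _ _ W IH; rewrite addE addr0 (_ : - m%:Z - 1 = - m.+1%:Z)//; lia.
Qed.

Section Kernel.
Variable R : realType.
Implicit Types (f g : site -> R) (x u : site) (K : R).

Lemma iter_avg_ge0 n f x : (forall y, 0 <= f y) -> 0 <= iter n (@avg R) f x.
Proof.
move=> f0; elim: n x => //= n IH x; rewrite divr_ge0//.
exact: sumr_ge0.
Qed.

Lemma delta_ge0 u x : 0 <= delta R u x.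
Proof. exact: ler0n. Qed.

Lemma delta_translate u : delta R u = translate (- u) (delta R 0).
Proof. by apply/funext => x; rewrite /delta /translate subr_eq0. Qed.

Lemma iter_avg_delta_even m x :
  iter (m + m) (@avg R) (delta R 0) x <= binwalk R (m + m) 0 ^+ 2.
Proof.
by rewrite iter_avg_delta ler_pM ?binwalk_ge0 ?binwalk_max.
Qed.

(** Even times come from the return probability; an odd time is one more averaging, at the price of
    the factor 2. *)
Lemma bdd_iter_avg_delta n u : bdd (2 / n.+1%:R) (iter n (@avg R) (delta R u)).
Proof.
rewrite delta_translate iter_avg_translate; apply: bdd_translate.
have even m : bdd (1 / (m + m).+1%:R) (iter (m + m) (@avg R) (delta R 0)).
  move=> x; rewrite ger0_norm; last by apply: iter_avg_ge0 => z; exact: delta_ge0.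
  apply: (le_trans (iter_avg_delta_even _ _)).
  by rewrite ler_pdivlMr ?ltr0n// mulrC -natr1 natrD binwalk_central_le.
rewrite -(odd_double_half n) -addnn; case: (odd n); rewrite /= ?add0n ?add1n.
  move=> x; apply: le_trans (bdd_avg (even _) x) _.
  rewrite ler_pdivlMr ?ltr0n// mulrAC ler_pdivrMr ?ltr0n// mul1r -!natr1 natrD.
  have : 0 <= n./2%:R :> R by [].
  lra.
by move=> x; apply: le_trans (even _ x) _; rewrite ler_pM2r ?invr_gt0 ?ltr0n//; lra.
Qed.

Lemma avg_pair_deltaN m x : avg_pair m (delta R 0) (- x) = avg_pair m (delta R 0) x.
Proof.
have symm n y : iter n (@avg R) (delta R 0) (- y) = iter n (@avg R) (delta R 0) y.
  by rewrite !iter_avg_delta /= -!opprD !binwalkN.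
by rewrite /avg_pair !symm -[avg _ (- x)]/(iter (m + m).+1 _ _ _) symm.
Qed.

(** By parity only one term of the pair is nonzero at a given site, and either is at most the return
    probability at time [2 m]. *)
Lemma avg_pair_delta_le m x :
  avg_pair m (delta R 0) x <= avg_pair m (delta R 0) 0.
Proof.
rewrite /avg_pair.
have -> : avg (iter (m + m) (@avg R) (delta R 0)) 0 = 0.
  by rewrite -iterS iter_avg_delta [binwalk _ _ _]binwalk_parity ?mul0r//=; lia.
rewrite addr0 [leRHS]iter_avg_delta.
rewrite -[leRHS]/(binwalk R (m + m) 0 * binwalk R (m + m) 0) -expr2.
case: (boolP (odd `|x.1 + x.2|)) => o.
  rewrite [iter _ _ _ _]iter_avg_delta [binwalk _ _ (_ + _)]binwalk_parity; last by lia.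
  rewrite mul0r add0r; apply: le_trans (ler_norm _) _.
  apply: (@bdd_avg _ (binwalk R (m + m) 0 ^+ 2)) => y.
  rewrite ger0_norm; last by apply: iter_avg_ge0 => z; exact: delta_ge0.
  exact: iter_avg_delta_even.
rewrite -iterS [iter (m + m).+1 _ _ _]iter_avg_delta.
rewrite [binwalk _ _.+1 (_ + _)]binwalk_parity ?mul0r ?addr0; last by lia.
exact: iter_avg_delta_even.
Qed.

(** The truncated potential kernel: [p_n 0 - p_n x] summed over [n < 2 N], in pairs so that every
    term is nonnegative. *)
Definition pot N x : R :=
  \sum_(m < N) (avg_pair m (delta R 0) 0 - avg_pair m (delta R 0) x).

Lemma potS N x : pot N.+1 x =
  pot N x + (avg_pair N (delta R 0) 0 - avg_pair N (delta R 0) x).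
Proof. by rewrite /pot big_ord_recr. Qed.

Lemma pot_nd x : nondecreasing_seq (pot ^~ x).
Proof.
apply/nondecreasing_seqP => N; rewrite potS lerDl subr_ge0.
exact: avg_pair_delta_le.
Qed.

Lemma pot_ge0 N x : 0 <= pot N x.
Proof. by apply: sumr_ge0 => m _; rewrite subr_ge0 avg_pair_delta_le. Qed.

Lemma pot0 N : pot N 0 = 0.
Proof. by rewrite /pot big1// => m _; rewrite subrr. Qed.

Lemma potN N x : pot N (- x) = pot N x.
Proof. by apply: eq_bigr => m _; rewrite avg_pair_deltaN. Qed.

(** The identity [(P - 1) (1 + P) P^(2 m) = P^(2 m + 2) - P^(2 m)] telescopes. *)
Lemma avg_pot N x : avg (pot N) x =
  pot N x + delta R 0 x - iter (N + N) (@avg R) (delta R 0) x.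
Proof.
elim: N x => [|N IH] x.
  by rewrite /avg /pot /= !big_ord0 big1 ?mul0r; [lra|move=> i _; rewrite big_ord0].
have -> : pot N.+1 = fun y => pot N y +
    (avg_pair N (delta R 0) 0 - avg_pair N (delta R 0) y).
  by apply/funext => y; rewrite potS.
rewrite (avgD (pot N)) (avgB (fun=> _)) avg_cst IH /avg_pair addSn addnS avgD /=.
lra.
Qed.

(** A Harnack step: a nonnegative function is at most four times its average at a neighbour, and
    [avg_pot] bounds that average by [pot N x + 1]. *)
Lemma pot_bounded x : exists B, forall N, pot N x <= B.
Proof.
elim/site_ind: x => [|x i [B hB]]; first by exists 0 => N; rewrite pot0.
exists (4 * (B + 1)) => N.
have h : pot N (x + dir i.+1) <= 4 * avg (pot N) x.
  rewrite /avg mulrC divfK// (bigD1 i)//= lerDl.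
  by apply: sumr_ge0 => j _; apply: pot_ge0.
apply: (le_trans h); rewrite ler_pM2l// avg_pot.
have := hB N; have : delta R 0 x <= 1 by rewrite /delta; case: eqP.
have := iter_avg_ge0 (N + N) x (delta_ge0 0).
lra.
Qed.

Definition potential x : R := limn (pot ^~ x).

Lemma cvg_pot x : pot ^~ x @ \oo --> potential x.
Proof.
apply: nondecreasing_is_cvgn; first exact: pot_nd.
by have [B hB] := pot_bounded x; exists B => _ [N _ <-].
Qed.

Lemma pot_le_potential N x : pot N x <= potential x.
Proof. by apply: nondecreasing_cvgn_le; [exact: pot_nd|exact: cvg_pot]. Qed.

Lemma potential_ge0 x : 0 <= potential x.
Proof. exact: le_trans (pot_ge0 0 x) (pot_le_potential 0 x). Qed.

Lemma potential0 : potential 0 = 0.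
Proof.
rewrite /potential (_ : pot ^~ 0 = fun=> 0) ?lim_cst//.
by apply/funext => N; rewrite pot0.
Qed.

Lemma potentialN x : potential (- x) = potential x.
Proof. by congr (limn _); apply/funext => N; apply: potN. Qed.

Lemma cvg_avg (F : nat -> site -> R) f x :
  (forall y, F ^~ y @ \oo --> f y) -> (fun N => avg (F N) x) @ \oo --> avg f x.
Proof.
move=> Ff; rewrite /avg; apply: cvgMr_tmp.
have -> : (fun N => \sum_(i < 4) F N (x + dir i.+1)) =
   \sum_(i < 4) (fun N => F N (x + dir i.+1)).
  by apply/funext => N; rewrite fct_sumE.
by rewrite big4 big4; do !apply: cvgD; apply: Ff.
Qed.

Lemma iter_avg_delta_cvg0 x :
  (fun N => iter (N + N) (@avg R) (delta R 0) x) @ \oo --> (0 : R).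
Proof.
apply: (@squeeze_cvgr _ _ _ _ (fun=> 0) (fun N => 2 * harmonic N)).
- near=> N; rewrite iter_avg_ge0/=; last by move=> y; exact: delta_ge0.
  apply: (le_trans (ler_norm _)); apply: (le_trans (bdd_iter_avg_delta _ _ _)).
  by rewrite ler_pM2l// lef_pV2 ?posrE ?ltr0n// ler_nat; lia.
- exact: cvg_cst.
- by rewrite -[X in _ --> X](mulr0 2); apply: cvgMl_tmp; apply: cvg_harmonic.
Unshelve. all: by end_near. Qed.

Lemma avg_potential x : avg potential x = potential x + delta R 0 x.
Proof.
apply: (cvg_unique (@norm_hausdorff _ R) (cvg_avg cvg_pot)).
have -> : (fun N => avg (pot N) x) = (fun N => pot N x + delta R 0 x
    - iter (N + N) (@avg R) (delta R 0) x).
  by apply/funext => N; rewrite avg_pot.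
rewrite /= -[X in _ --> X]subr0; apply: cvgB; last exact: iter_avg_delta_cvg0.
by apply: cvgD; [exact: cvg_pot|exact: cvg_cst].
Qed.

(** The first term of the series suffices: the pair at [m = 0] is 1 at the origin and at most 1 / 4
    elsewhere. *)
Lemma potential_gt0 x : x != 0 -> 0 < potential x.
Proof.
move=> x0; apply: lt_le_trans (pot_le_potential 1 x).
rewrite /pot big_ord_recl big_ord0 addr0 subr_gt0 /avg_pair /= /delta (negPf x0) eqxx.
rewrite /avg !big4 /= !xpair_eqE /=.
have h (b1 b2 b3 b4 : bool) : ~~ (b1 && b2) -> ~~ (b3 && b4) -> ~~ (b1 && b3) ->
   ~~ (b1 && b4) -> ~~ (b2 && b3) -> ~~ (b2 && b4) ->
  (b1%:R + b2%:R + b3%:R + b4%:R : R) <= 1.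
  by case: b1 b2 b3 b4 => [] [] [] []//= *; lra.
have := h (x + dir 1 == 0) (x + dir 2 == 0) (x + dir 3 == 0) (x + dir 4 == 0).
case: x x0 => p q _; rewrite /= !xpair_eqE /= => h'.
have := h' ltac:(lia) ltac:(lia) ltac:(lia) ltac:(lia) ltac:(lia) ltac:(lia).
lra.
Qed.
End Kernel.

(** * Growth of the kernel and summability of its differences *)

Section Estimates.
Variable R : realType.
Implicit Types (f g : site -> R) (x u : site) (K : R).

Lemma cvg_le_bound (v : nat -> R) l B :
  v @ \oo --> l -> (forall N, v N <= B) -> l <= B.
Proof.
move=> vl vB; rewrite -(cvg_lim (@norm_hausdorff _ R) vl).
by apply: limr_le; [apply/cvg_ex; exists l|apply: nearW].
Qed.

(** About half of the averages first flatten [f] by the heat kernel bound; the other half is left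
    for the difference estimates. *)
Lemma avg_pair_split m f :
  avg_pair m f = avg_pair m./2 (iter (m + m - (m./2 + m./2)) (@avg R) f).
Proof. by rewrite /avg_pair -iterD subnKC//; lia. Qed.

Lemma first_diff_kernel m (j : 'I_4) u x :
  `|avg_pair m (delta R u) (x + dir j.+1) - avg_pair m (delta R u) x|
  <= 32 / Num.sqrt m.+1%:R ^+ 3.
Proof.
rewrite avg_pair_split; set r := (_ - _)%N.
apply: le_trans (first_diff_avg_pair _ _ _ (@bdd_iter_avg_delta R r u)) _.
have s0 n : 0 < Num.sqrt n.+1%:R :> R by rewrite sqrtr_gt0.
have h1 : 2 / r.+1%:R <= 2 / Num.sqrt m.+1%:R ^+ 2 :> R.
  rewrite sqr_sqrtr ?ler0n// ler_pM2l// lef_pV2 ?posrE ?ltr0n// ler_nat /r; lia.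
have h2 : Num.sqrt m.+1%:R <= 2 * Num.sqrt (m./2).+1%:R :> R.
  have -> : 2 = Num.sqrt (2 ^+ 2) :> R by rewrite sqrtr_sqr ger0_norm.
  rewrite -sqrtrM ?ler0n// ler_sqrt ?mulr_ge0// -natrX -natrM ler_nat; lia.
have -> : 32 / Num.sqrt m.+1%:R ^+ 3 =
    8 * (2 / Num.sqrt m.+1%:R ^+ 2) * (2 / Num.sqrt m.+1%:R) :> R.
  by have := s0 m; move=> ?; field; lra.
apply: ler_pM.
- by rewrite mulr_ge0// divr_ge0.
- by rewrite invr_ge0 ltW.
- by rewrite ler_pM2l.
by rewrite ler_pdivlMr// ler_pdivrMl// mulrC.
Qed.

(** Telescoping: for [t ^+ 2 = s ^+ 2 + 1], the cube of [1 / t] is at most [2 / s - 2 / t]. *)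
Lemma sum_inv_sqrt_cube N : \sum_(m < N.+1) (Num.sqrt m.+1%:R ^+ 3)^-1
  <= 3 - 2 / Num.sqrt N.+1%:R :> R.
Proof.
elim: N => [|N IH]; first by rewrite big_ord_recl big_ord0 /= sqrtr1; lra.
rewrite big_ord_recr /=.
have s0 n : 0 < Num.sqrt n.+1%:R :> R by rewrite sqrtr_gt0.
have : Num.sqrt N.+2%:R ^+ 2 = Num.sqrt N.+1%:R ^+ 2 + 1 :> R.
  by rewrite !sqr_sqrtr ?ler0n// -natr1.
have := s0 N; have := s0 N.+1; move: IH.
set S := \sum_(_ < _) _.
move: (Num.sqrt N.+1%:R) (Num.sqrt N.+2%:R) => s t IH t0 s0' ts.
suff : (t ^+ 3)^-1 <= 2 / s - 2 / t by move: IH; lra.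
have -> : 2 / s - 2 / t = (2 * t ^+ 2 * (t - s)) / (s * t ^+ 3) by field; lra.
have -> : (t ^+ 3)^-1 = s / (s * t ^+ 3) by field; lra.
have st : s <= t by rewrite -ler_sqr ?nnegrE; lra.
rewrite ler_pM2r ?invr_gt0 ?mulr_gt0 ?exprn_gt0//.
have -> : t - s = (t + s)^-1.
  apply: (@mulfI R (t + s)); first lra.
  by rewrite mulfV; [rewrite mulrC -subr_sqr; lra|lra].
by rewrite ler_pdivlMr; nra.
Qed.

Lemma pot_lipschitz N x (j : 'I_4) : `|pot R N (x + dir j.+1) - pot R N x| <= 96.
Proof.
rewrite /pot -sumrB; apply: (le_trans (ler_norm_sum _ _ _)).
apply: (@le_trans _ _ (\sum_(m < N) 32 * (Num.sqrt m.+1%:R ^+ 3)^-1)).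
  apply: ler_sum => m _; rewrite opprB addrC addrA subrK distrC.
  exact: first_diff_kernel.
rewrite -mulr_sumr (_ : 96 = 32 * 3); last by lra.
rewrite ler_pM2l//; case: N => [|N]; first by rewrite big_ord0.
apply: le_trans (sum_inv_sqrt_cube N) _.
by rewrite gerBl divr_ge0// sqrtr_ge0.
Qed.

Lemma potential_lipschitz x (j : 'I_4) :
  `|potential R (x + dir j.+1) - potential R x| <= 96.
Proof.
apply: (@cvg_le_bound (fun N => `|pot R N (x + dir j.+1) - pot R N x|)).
  by apply: cvg_norm; apply: cvgB; apply: cvg_pot.
by move=> N; apply: pot_lipschitz.
Qed.

Lemma potential_shift_bounded v :
  exists B, forall x, `|potential R (x + v) - potential R x| <= B.
Proof.
elim/site_ind: v => [|v i [B hB]]; first by exists 0 => x; rewrite addr0 subrr normr0.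
exists (96 + B) => x; rewrite addrA.
rewrite -(subrKA (potential R (x + v))); apply: (le_trans (ler_normD _ _)).
by rewrite lerD// potential_lipschitz.
Qed.

(** The first [N + 1] pairs vanish at a site too far to be reached in that time, so [pot] there is a
    sum of return probabilities, which dominates a multiple of the harmonic series. *)
Lemma potential_infty K : exists r : nat, forall x : site,
  (r < maxn `|x.1| `|x.2|)%N -> K <= potential R x.
Proof.
have : exists N, K <= \sum_(m < N) (4 * m.+1%:R)^-1 :> R.
  apply: contrapT => /forallNP h.
  have ub N : \sum_(m < N) (4 * m.+1%:R)^-1 <= K :> R.
    by apply/ltW; rewrite ltNge; apply/negP; apply: h.
  apply: (@dvg_harmonic R); apply: nondecreasing_is_cvgn.
    apply/nondecreasing_seqP => n; rewrite /series /= big_nat_recr//= lerDl.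
    by rewrite invr_ge0.
  exists (4 * K) => _ [N _ <-]; rewrite /series /= big_mkord.
  rewrite -ler_pdivrMl// mulr_sumr; apply: le_trans (ub N).
  by apply: ler_sum => m _; rewrite invfM.
case=> N hN; exists (N.+1 + N.+1)%N => x hx.
apply: le_trans (pot_le_potential _ N.+1 x).
rewrite /pot big_ord_recl.
have far n : (n <= N.+1 + N.+1)%N -> iter n (@avg R) (delta R 0) x = 0.
  move=> hn; rewrite iter_avg_delta.
  have [h|h] : (n < absz (x.1 + x.2)%R)%N \/ (n < absz (x.1 - x.2)%R)%N by lia.
    by rewrite binwalk_far// mul0r.
  by rewrite [X in _ * X]binwalk_far// mulr0.
apply: (le_trans hN); rewrite -[leLHS]add0r; apply: lerD.
  by rewrite subr_ge0 avg_pair_delta_le.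
apply: ler_sum => m _; rewrite /= /bump /= add1n.
have -> : avg_pair m.+1 (delta R 0) x = 0.
  by rewrite /avg_pair -iterS !far ?addr0//; have := ltn_ord m; lia.
rewrite subr0; apply: (@le_trans _ _ (binwalk R (m.+1 + m.+1) 0 ^+ 2)).
  rewrite -[leLHS]mul1r ler_pdivrMr ?mulr_gt0// mulrC.
  exact: binwalk_central_ge.
rewrite /avg_pair iter_avg_delta expr2 lerDl.
rewrite -iterS; apply: iter_avg_ge0 => y; exact: delta_ge0.
Qed.

Lemma sum_harmonic_le_ln (K : nat) :
  \sum_(m < K.+1) m.+1%:R^-1 <= 1 + ln K.+1%:R :> R.
Proof.
elim: K => [|K IH]; first by rewrite big_ord_recl big_ord0 /= ln1; lra.
rewrite big_ord_recr /=.
suff : K.+2%:R^-1 <= ln K.+2%:R - ln K.+1%:R :> R.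
  by move: IH; move: (\sum_(_ < _) _) _^-1 (ln _) (ln _) => a b c d; lra.
have := @le_ln1Dx R (- K.+2%:R^-1).
have -> : 1 + - K.+2%:R^-1 = K.+1%:R / K.+2%:R :> R.
  rewrite -[K.+2%:R]natr1; have : 0 < K.+1%:R :> R by [].
  by move: (K.+1%:R : R) => y y0; field; lra.
rewrite ln_div ?posrE ?ltr0n//.
have : K.+2%:R^-1 < 1 :> R by rewrite invf_lt1 ?ltr0n// ltr1n.
move: (ln _) (ln _) (K.+2%:R^-1) => c b a a1 h.
by have := h ltac:(lra); lra.
Qed.

(** The first bound serves for [m <= K]. Beyond, [1 / (m + 1)^2 <= 1 / m - 1 / (m + 1)] telescopes,
    and the second bound contributes at most [C]. *)
Lemma sum_min_le_ln (K N : nat) (F : nat -> R) (C : R) : 0 <= C ->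
  (forall m, F m <= C / m.+1%:R) -> (forall m, F m <= C * K.+1%:R / m.+1%:R ^+ 2) ->
  \sum_(m < N) F m <= C * (2 + ln K.+1%:R).
Proof.
move=> C0 F1 F2.
have small n : \sum_(m < n) F m <= C * \sum_(m < n) m.+1%:R^-1.
  by rewrite mulr_sumr; apply: ler_sum => m _; apply: F1.
have head : \sum_(m < K.+1) F m <= C * (1 + ln K.+1%:R).
  by apply: le_trans (small _) _; rewrite ler_wpM2l// sum_harmonic_le_ln.
have tail n : \sum_(m < K.+1 + n) F m <= C * (1 + ln K.+1%:R)
    + C * K.+1%:R * (K.+1%:R^-1 - (K.+1 + n)%:R^-1).
  elim: n => [|n IH]; first by rewrite addn0 subrr mulr0 addr0.
  rewrite addnS big_ord_recr /=; apply: le_trans (lerD IH (F2 _)) _.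
  rewrite -addrA lerD2l -mulrDr ler_wpM2l ?mulr_ge0//.
  move: (K.+1 + n)%N (isT : (0 < K.+1 + n)%N) => p p0.
  have p0' : 0 < p%:R :> R by rewrite ltr0n.
  rewrite -addrA lerD2l -natr1; move: (p%:R : R) p0' => t t0.
  have -> : - (t + 1)^-1 = - t^-1 + (t * (t + 1))^-1 by field; lra.
  by rewrite lerD2l lef_pV2 ?posrE; nra.
have [NK|KN] := leqP K.+1 N.
  rewrite -(subnKC NK); apply: le_trans (tail _) _.
  rewrite (_ : 2 + _ = 1 + ln K.+1%:R + 1); last by lra.
  rewrite [leRHS]mulrDr mulr1 lerD2l -mulrA ler_piMr// mulrBr mulfV ?pnatr_eq0//.
apply: le_trans (small _) _; rewrite ler_wpM2l//.
apply: (@le_trans _ _ (1 + ln K.+1%:R)); last by lra.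
apply: le_trans (sum_harmonic_le_ln K).
rewrite -(big_mkord xpredT (fun m => m.+1%:R^-1)) -(big_mkord xpredT (fun m => m.+1%:R^-1)).
rewrite (@big_cat_nat _ _ _ N 0 K.+1)//=; last exact: ltnW.
by rewrite lerDl sumr_ge0// => m _; rewrite invr_ge0.
Qed.

(* Duality: with F the sum of the signed unit masses [s u] at the points u of B,
   the sum of the absolute second differences of the kernel over B is the second
   difference at a single point of the kernel applied to F; here [|F| <= 1]
   and [P^n F] is at most [2 |B| / (n + 1)]. *)
Lemma sum_second_diff_pot (B : seq site) (K N : nat) (i j : 'I_4) v :
  uniq B -> (size B <= K.+1)%N ->
  \sum_(u <- B) `|pot R N (u + v + dir i.+1 + dir j.+1) - pot R N (u + v + dir i.+1)
    - pot R N (u + v + dir j.+1) + pot R N (u + v)| <= 96 * (2 + ln K.+1%:R).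
Proof.
move=> uB sB.
pose kap m := avg_pair m (delta R 0).
pose D2 f (y : site) := f (y + dir i.+1 + dir j.+1) - f (y + dir i.+1)
  - f (y + dir j.+1) + f y : R.
pose s u := Num.sg (D2 (pot R N) (u + v)).
pose F y := \sum_(u <- B) s u * delta R u y.
have s1 u : `|s u| <= 1 by rewrite normr_sg lern1 leq_b1.
have F1 : bdd 1 F.
  move=> y; apply: le_trans (ler_norm_sum _ _ _) _.
  apply: (@le_trans _ _ (\sum_(u <- B) (u == y)%:R)).
    apply: ler_sum => u _; rewrite normrM /delta eq_sym.
    by rewrite [X in _ * X]ger0_norm// ler_piMl.
  by rewrite -natr_sum -big_mkcond sum1_count count_uniq_mem// lern1 leq_b1.
have FK n : bdd (2 * K.+1%:R / n.+1%:R) (iter n (@avg R) F).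
  move=> y; rewrite iter_avg_lin; apply: le_trans (ler_norm_sum _ _ _) _.
  apply: (@le_trans _ _ (\sum_(u <- B) 2 / n.+1%:R)).
    apply: ler_sum => u _; rewrite normrM.
    apply: le_trans (@bdd_iter_avg_delta R n u y).
    by rewrite ler_piMl.
  rewrite big_const_seq count_predT iter_addr_0 -[_ *+ size B]mulr_natr mulrAC.
  by rewrite ler_pM2r ?invr_gt0 ?ltr0n// ler_pM2l// ler_nat.
have pairF m y : avg_pair m F y = \sum_(u <- B) s u * avg_pair m (delta R u) y.
  rewrite /avg_pair -!iterS !iter_avg_lin -big_split /=.
  by apply: eq_bigr => u _; rewrite mulrDr -!iterS.
have kapE m u y : kap m (u - y) = avg_pair m (delta R u) y.
  rewrite /kap -avg_pair_deltaN opprB /avg_pair -!iterS.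
  by rewrite (delta_translate R u) !iter_avg_translate.
(* The map [y -> u - y] exchanges the four points around this [x] with those around [u + v], so one
   [x] serves all [u]. *)
pose x := - v - dir i.+1 - dir j.+1.
have D2k m u : D2 (avg_pair m (delta R u)) x = D2 (kap m) (u + v).
  rewrite /D2 -!kapE /x.
  have -> : u - (- v - dir i.+1 - dir j.+1 + dir i.+1 + dir j.+1) = u + v.
    by rewrite addrAC subrK subrK opprK.
  have -> : u - (- v - dir i.+1 - dir j.+1 + dir i.+1) = u + v + dir j.+1.
    by rewrite addrAC subrK opprD !opprK addrA.
  have -> : u - (- v - dir i.+1 - dir j.+1 + dir j.+1) = u + v + dir i.+1.
    by rewrite subrK opprD !opprK addrA.
  have -> : u - (- v - dir i.+1 - dir j.+1) = u + v + dir i.+1 + dir j.+1.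
    by rewrite !opprD !opprK !addrA.
  lra.
have D2E u : D2 (pot R N) (u + v) = - \sum_(m < N) D2 (avg_pair m (delta R u)) x.
  under eq_bigr do rewrite D2k.
  rewrite /D2 /pot -!sumrB -big_split -sumrN; apply: eq_bigr => m _.
  rewrite -/(kap m) -!/(kap m _) /=; lra.
have -> : \sum_(u <- B) `|D2 (pot R N) (u + v)| = - \sum_(m < N) D2 (avg_pair m F) x.
  have -> : \sum_(m < N) D2 (avg_pair m F) x =
      \sum_(u <- B) s u * \sum_(m < N) D2 (avg_pair m (delta R u)) x.
    under [RHS]eq_bigr do rewrite mulr_sumr.
    rewrite [RHS]exchange_big /=; apply: eq_bigr => m _.
    rewrite /D2 !pairF -!sumrB -big_split /=; apply: eq_bigr => u _; lra.
  rewrite -sumrN; apply: eq_bigr => u _.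
  by rewrite -mulrN -D2E -normrEsg.
rewrite -sumrN; apply: (@sum_min_le_ln K N (fun m => - D2 (avg_pair m F) x)) => // m.
  apply: le_trans (ler_norm _) _; rewrite normrN.
  apply: le_trans (second_diff_avg_pair _ _ _ _ F1) _.
  by rewrite ler_pM2r ?invr_gt0 ?ltr0n//; lra.
apply: le_trans (ler_norm _) _; rewrite normrN avg_pair_split.
apply: le_trans (second_diff_avg_pair _ _ _ _ (FK _)) _.
set r := (_ - _)%N.
have h1 : r.+1%:R^-1 <= m.+1%:R^-1 :> R.
  by rewrite lef_pV2 ?posrE ?ltr0n// ler_nat /r; lia.
have h2 : (m./2).+1%:R^-1 <= 2 * m.+1%:R^-1 :> R.
  rewrite ler_pdivlMr ?ltr0n// ler_pdivrMl ?ltr0n// -natrM ler_nat; lia.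
rewrite (_ : 96 * _ / _ = 24 * (2 * K.+1%:R * m.+1%:R^-1) * (2 * m.+1%:R^-1)).
  by rewrite ler_pM ?mulr_ge0// ler_pM2l// ler_wpM2l// mulr_ge0.
by field; rewrite addrC natr1 pnatr_eq0.
Qed.

End Estimates.

(** * The harmonic function with values 1 at b and 0 at c *)

Definition box (r : nat) : seq site :=
  [seq (i%:Z - r%:Z, j%:Z - r%:Z) | i <- iota 0 r.*2.+1, j <- iota 0 r.*2.+1].

Lemma size_box r : size (box r) = (r.*2.+1 ^ 2)%N.
Proof. by rewrite size_allpairs size_iota. Qed.

Lemma mem_box r (u : site) : (u \in box r) = (`|u.1| <= r)%N && (`|u.2| <= r)%N.
Proof.
case: u => p q /=; apply/allpairsP/andP => [[[i j] [hi hj [-> ->]]]|[hp hq]].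
  by move: hi hj; rewrite !mem_iota /= => hi hj; split; lia.
exists (absz (p + r%:Z), absz (q + r%:Z)); rewrite !mem_iota.
by split; [move=> /=; lia|move=> /=; lia|move=> /=; congr pair; lia].
Qed.

Lemma box_uniq r : uniq (box r).
Proof.
apply: allpairs_uniq; rewrite ?iota_uniq// => -[i j] [i' j'] _ _ /= [].
by move=> h1 h2; congr pair; lia.
Qed.

Section Voltage.
Variable R : realType.
Implicit Types (f g : site -> R) (x u : site) (K : R).

Lemma seq_argmax (I : eqType) (s : seq I) (f : I -> R) (i0 : I) : i0 \in s ->
  exists2 m, m \in s & {in s, forall i, f i <= f m}.
Proof.
elim: s i0 => [//|j s IH] i0 _.
case: s IH => [|k s] IH; first by exists j; rewrite ?inE// => i; rewrite inE => /eqP->.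
have [m ms hm] := IH k (mem_head _ _).
have [jm|mj] := leP (f j) (f m).
  by exists m => [|i]; rewrite inE ?ms ?orbT// => /orP[/eqP->|/hm].
exists j; first exact: mem_head.
by move=> i; rewrite inE => /orP[/eqP->|/hm /le_trans]; last by apply; apply: ltW.
Qed.

(* Maximum principle: [phi - eps A(. - b)] is negative far away, and its maximum
   would propagate along a half-line. *)
Lemma bounded_harmonic_le0 (b c : site) K (phi : site -> R) :
  bdd K phi -> (forall u, u != b -> u != c -> avg phi u = phi u) ->
  phi b <= 0 -> phi c <= 0 -> forall u, phi u <= 0.
Proof.
move=> phiK harm pb pc u0; rewrite leNgt; apply/negP => u0pos.
pose A x := potential R (x - b).
have A0 x : 0 <= A x by exact: potential_ge0.
(* Small enough that [e * A u0 < phi u0]; the [+ 1] allows for [A u0 = 0]. *)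
pose e := phi u0 / (2 * (A u0 + 1)).
have d0 : 0 < 2 * (A u0 + 1) by have := A0 u0; lra.
have e0 : 0 < e by rewrite divr_gt0.
pose psi x := phi x - e * A x.
have psi0 : 0 < psi u0.
  rewrite /psi /e subr_gt0 mulrAC ltr_pdivrMr// ltr_pM2l//.
  by have := A0 u0; lra.
have [r hr] := potential_infty ((K + 1) / e).
have psi_far x : (r < maxn (absz (x - b)%R.1) (absz (x - b)%R.2))%N -> psi x < 0.
  move=> /hr; rewrite ler_pdivrMr// mulrC -/(A x) => h.
  have := phiK x; rewrite ler_norml /psi => /andP[_ ?]; lra.
have harmpsi x : x != b -> x != c -> avg psi x = psi x.
  move=> xb xc; rewrite /psi avgB harm// avgZ.
  have -> : avg A x = A x.
    rewrite /A (_ : (fun y => _) = translate (- b) (potential R))//.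
    by rewrite avg_translate /translate avg_potential /delta subr_eq0 (negPf xb) addr0.
  by [].
have : u0 - b \in box r.
  rewrite mem_box -geq_max leqNgt; apply/negP => /psi_far /lt_trans /(_ psi0).
  by rewrite ltxx.
case/(@seq_argmax _ _ (fun w => psi (b + w))) => m mB hm.
have Mpos : 0 < psi (b + m).
  apply: (lt_le_trans psi0).
  rewrite -{1}(subrKC b u0); apply: hm.
  rewrite mem_box -geq_max leqNgt; apply/negP => /psi_far /lt_trans /(_ psi0).
  by rewrite ltxx.
have top x : psi x <= psi (b + m).
  case: (boolP (x - b \in box r)) => [/hm|]; first by rewrite subrKC.
  rewrite mem_box -geq_max -ltnNge => /psi_far h.
  by apply: ltW; apply: lt_trans Mpos.
have ray (k : nat) : psi (b + m + (k%:Z, 0)) = psi (b + m).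
  elim: k => [|k IH]; first by rewrite addr0.
  set x := b + m + (k%:Z, 0) in IH.
  have -> : b + m + (k.+1%:Z, 0) = x + dir 4.
    have -> : ((k.+1%:Z, 0) : site) = (k%:Z + 1, 0) by congr pair; lia.
    by rewrite /x -[RHS]addrA.
  (* As [psi <= phi <= 0] at b and c while [psi x] is the positive maximum, the half-line avoids
     both and [psi] is harmonic along it. *)
  have ps y : psi y <= phi y by rewrite /psi gerBl mulr_ge0// ltW.
  have xb : x != b by apply/eqP => xb; have := ps x; rewrite IH xb; lra.
  have xc : x != c by apply/eqP => xc; have := ps x; rewrite IH xc; lra.
  have := harmpsi x xb xc; rewrite IH /avg big4.
  have := top (x + dir 1); have := top (x + dir 2); have := top (x + dir 3).
  have := top (x + dir 4) => /= h4 h3 h2 h1.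
  move=> h; apply/eqP; rewrite eq_le h4 /=.
  move: h1 h2 h3 h4 h => /=; lra.
pose k := (`|m.1| + r).+1.
have : psi (b + m + (k%:Z, 0)) < 0.
  have far (p q : int) : (r < maxn (absz (p + (absz p + r).+1%:Z)%R) (absz q))%N by lia.
  by apply: psi_far; rewrite addrAC [b + m]addrC addrK; apply: far.
by rewrite ray => /lt_trans /(_ Mpos); rewrite ltxx.
Qed.

Lemma bounded_harmonic_unique (b c : site) K K' (f g : site -> R) :
  bdd K f -> bdd K' g ->
  (forall u, u != b -> u != c -> avg f u = f u) ->
  (forall u, u != b -> u != c -> avg g u = g u) ->
  f b = g b -> f c = g c -> f = g.
Proof.
move=> fK gK hf hg eb ec; apply/funext => u; apply/eqP; rewrite eq_le.
rewrite -[X in X && _]subr_le0 -[X in _ && X]subr_le0; apply/andP; split.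
  apply: (@bounded_harmonic_le0 b c _ (fun x => f x - g x) (bddB fK gK)).
  - by move=> x xb xc; rewrite avgB hf// hg.
  - by rewrite eb subrr.
  - by rewrite ec subrr.
apply: (@bounded_harmonic_le0 b c _ (fun x => g x - f x) (bddB gK fK)).
- by move=> x xb xc; rewrite avgB hf// hg.
- by rewrite eb subrr.
- by rewrite ec subrr.
Qed.

Variables b c : site.
Hypothesis bc : b <> c.

(** The constants are fixed by [potential0] and by the evenness of [potential], so that the values
    at b and c are 1 and 0. *)
Definition voltage u : R := 1 / 2 +
  (potential R (u - c) - potential R (u - b)) / (2 * potential R (b - c)).

Let res_gt0 : 0 < potential R (b - c).
Proof. by apply: potential_gt0; rewrite subr_eq0; apply/eqP. Qed.

Lemma voltage_b : voltage b = 1.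
Proof. by rewrite /voltage subrr potential0; move: res_gt0 => ?; field; lra. Qed.

Lemma voltage_c : voltage c = 0.
Proof.
rewrite /voltage subrr potential0 -(opprB b c) potentialN.
by move: res_gt0 => ?; field; lra.
Qed.

Lemma voltage_harmonic u : u != b -> u != c -> avg voltage u = voltage u.
Proof.
have E : voltage = fun u => 1 / 2 + (2 * potential R (b - c))^-1 *
    (translate (- c) (potential R) u - translate (- b) (potential R) u).
  by apply/funext => x; rewrite [_^-1 * _]mulrC.
move=> ub uc; rewrite E avgD avg_cst avgZ avgB !avg_translate /translate.
by rewrite !avg_potential /delta !subr_eq0 (negPf ub) (negPf uc) !addr0.
Qed.

Lemma voltage_bounded : exists K, bdd K voltage.
Proof.
have [B hB] := potential_shift_bounded R (b - c).
exists (1 + B / (2 * potential R (b - c))) => u; rewrite /voltage.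
apply: le_trans (ler_normD _ _) _; apply: lerD; first by rewrite ger0_norm; lra.
rewrite normrM normfV (gtr0_norm (x := _ * _)) ?mulr_gt0//.
rewrite ler_pM2r ?invr_gt0 ?mulr_gt0//.
have -> : u - c = u - b + (b - c) by rewrite addrA subrK.
exact: hB.
Qed.

Lemma sum_second_diff_potential (B : seq site) (K : nat) (i j : 'I_4) v :
  uniq B -> (size B <= K.+1)%N ->
  \sum_(u <- B) `|potential R (u + v + dir i.+1 + dir j.+1)
    - potential R (u + v + dir i.+1)
    - potential R (u + v + dir j.+1) + potential R (u + v)|
  <= 96 * (2 + ln K.+1%:R).
Proof.
move=> uB sB; apply: cvg_le_bound; last first.
  by move=> N; apply: (@sum_second_diff_pot R B K N i j v uB sB).
elim: B {uB sB} => [|u B IH].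
  rewrite big_nil (_ : (fun _ => _) = fun=> 0); first exact: cvg_cst.
  by apply/funext => N; rewrite big_nil.
rewrite big_cons; under eq_fun do rewrite big_cons.
apply: cvgD IH; apply: cvg_norm.
by apply: cvgD; [apply: cvgB; [apply: cvgB|]|]; apply: cvg_pot.
Qed.

(** The gradient of [voltage] compares that of [potential] at [u - b] and [u - c]. A path of unit
    steps from 0 to [b - c] writes this as a sum of second differences, summed over [B] one step at
    a time. *)
Lemma voltage_gradient : exists2 C, 0 <= C & forall (B : seq site) (K : nat),
  uniq B -> (size B <= K.+1)%N ->
  \sum_(u <- B) \sum_(i < 4) `|voltage (u + dir i.+1) - voltage u|
  <= C * (2 + ln K.+1%:R).
Proof.
have dipole w : exists2 C, 0 <= C & forall (B : seq site) (K : nat) (i : 'I_4) v,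
    uniq B -> (size B <= K.+1)%N ->
    \sum_(u <- B) `|potential R (u + v + w + dir i.+1) - potential R (u + v + w)
      - (potential R (u + v + dir i.+1) - potential R (u + v))|
    <= C * (2 + ln K.+1%:R).
  elim/site_ind: w => [|w j [C C0 hC]].
    exists 0 => // B K i v _ _; rewrite mul0r big1// => u _.
    by rewrite addr0 subrr normr0.
  exists (C + 96); first by lra.
  move=> B K i v uB sB; rewrite mulrDl.
  apply: le_trans (lerD (hC _ _ i v uB sB) (sum_second_diff_potential j i (v + w) uB sB)).
  rewrite -big_split /=; apply: ler_sum => u _; rewrite !addrA.
  by apply: le_trans (ler_normD _ _); rewrite le_eqVlt; apply/orP; left; apply/eqP;
    congr `|_|; lra.
have [C C0 hC] := dipole (b - c).
pose A := (2 * potential R (b - c))^-1.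
have A0 : 0 < A by rewrite invr_gt0 mulr_gt0.
exists (4 * (A * C)); first by rewrite !mulr_ge0// ltW.
move=> B K uB sB; rewrite exchange_big /=.
apply: (@le_trans _ _ (\sum_(i < 4) A * C * (2 + ln K.+1%:R))); last first.
  by rewrite big4; lra.
apply: ler_sum => i _; rewrite -mulrA -ler_pdivrMl// mulr_sumr.
apply: le_trans (hC _ _ i (- b) uB sB); apply: ler_sum => u _.
rewrite ler_pdivrMl// -[A in A * _]gtr0_norm// -normrM /voltage -/A.
have -> : u - b + (b - c) = u - c by rewrite addrA subrK.
have -> : u + dir i.+1 - c = u - c + dir i.+1 by rewrite addrAC.
have -> : u + dir i.+1 - b = u - b + dir i.+1 by rewrite addrAC.
by rewrite le_eqVlt; apply/orP; left; apply/eqP; congr `|_|; lra.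
Qed.

End Voltage.

(** * The Markov chain *)

Lemma dir_inj (i j : 'I_4) : dir i.+1 = dir j.+1 -> i = j.
Proof.
case: i j => [[|[|[|[|i]]]] hi] [[|[|[|[|j]]]] hj] //= e; apply/val_inj => //=;
  by move: e => [] //; lia.
Qed.

Lemma dist1_dir (u : site) (i : 'I_4) : dist1 u (u + dir i.+1) = 1.
Proof.
case: u => p q; rewrite /dist1.
by case: i => [[|[|[|[|i]]]] hi] //=; lia.
Qed.

Section Chain.
Variable R : realType.
Variables a b c : site.
Hypothesis bc : b <> c.

Lemma returning_start : returning b c (start a b c) = false.
Proof.
by rewrite /start /returning; case: ifP => // /norP[ab ac]; apply/norP.
Qed.

Lemma origin_start : origin a (start a b c) = a.
Proof. by rewrite /start; case: ifP. Qed.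

(* The probability that the walk from u is at [tgt] when it first visits
   {b, c}, and that this happens within N steps. *)
Fixpoint absorb (tgt : site) N u : R :=
  if (u == b) || (u == c) then (u == tgt)%:R
  else if N is N'.+1 then avg (absorb tgt N') u else 0.

Lemma absorb_boundary tgt N u : (u == b) || (u == c) -> absorb tgt N u = (u == tgt)%:R.
Proof. by case: N => [|N] /= ->. Qed.

Lemma absorb_ge0 tgt N u : 0 <= absorb tgt N u.
Proof.
elim: N u => [|N IH] u /=; case: ifP => // _.
by rewrite divr_ge0// sumr_ge0.
Qed.

Lemma absorb_le1 tgt N u : absorb tgt N u <= 1.
Proof.
elim: N u => [|N IH] u /=; case: ifP => _ //; rewrite ?lern1 ?leq_b1//.
by rewrite -[leRHS]/((fun=> 1) u) -[X in _ <= X u]avg_cst; apply: avg_le.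
Qed.

Lemma absorb_nd tgt u : nondecreasing_seq (fun N => absorb tgt N u).
Proof.
apply/nondecreasing_seqP => N.
elim: N u => [|N IH] u /=; case: ifP => // _; last exact: avg_le.
by rewrite divr_ge0// sumr_ge0// => i _; case: ifP.
Qed.

Definition absorb_lim tgt u := limn (fun N => absorb tgt N u).

Lemma cvg_absorb tgt u : (fun N => absorb tgt N u) @ \oo --> absorb_lim tgt u.
Proof.
apply: nondecreasing_is_cvgn; first exact: absorb_nd.
by exists 1 => _ [N _ <-]; apply: absorb_le1.
Qed.

Lemma absorb_lim_boundary tgt u :
  (u == b) || (u == c) -> absorb_lim tgt u = (u == tgt)%:R.
Proof.
move=> h; rewrite /absorb_lim (_ : (fun N => _) = fun=> (u == tgt)%:R) ?lim_cst//.
by apply/funext => N; rewrite absorb_boundary.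
Qed.

Lemma bdd_absorb_lim tgt : bdd 1 (absorb_lim tgt).
Proof.
move=> u; apply: (@cvg_le_bound R (fun N => `|absorb tgt N u|)).
  by apply: cvg_norm; apply: cvg_absorb.
by move=> N; rewrite ger0_norm ?absorb_ge0// absorb_le1.
Qed.

Lemma absorb_lim_harmonic tgt u : u != b -> u != c ->
  avg (absorb_lim tgt) u = absorb_lim tgt u.
Proof.
move=> ub uc.
have h1 := @cvg_avg R (absorb tgt) (absorb_lim tgt) u (@cvg_absorb tgt).
have h2 := @cvg_absorb tgt u; rewrite -(cvg_shiftS _) in h2.
apply: (cvg_unique (@norm_hausdorff _ R) h1).
rewrite /= (_ : (fun N => _) = fun N => absorb tgt N.+1 u)//.
by apply/funext => N; rewrite /= (negPf ub) (negPf uc).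
Qed.

Lemma absorb_lim_b : absorb_lim b = voltage R b c.
Proof.
have [K hK] := voltage_bounded R bc.
apply: (bounded_harmonic_unique (b := b) (c := c) (bdd_absorb_lim b) hK).
- exact: absorb_lim_harmonic.
- exact: voltage_harmonic.
- by rewrite absorb_lim_boundary eqxx// voltage_b.
rewrite absorb_lim_boundary ?eqxx ?orbT// voltage_c//.
by rewrite (_ : (c == b) = false)//; apply/eqP => e; apply: bc.
Qed.

(** With [absorb_lim_b], absorption is certain: recurrence, obtained here from uniqueness of bounded
    harmonic functions. *)
Lemma absorb_lim_c : absorb_lim c = fun u => 1 - voltage R b c u.
Proof.
have [K hK] := voltage_bounded R bc.
have one : bdd 1 (fun=> 1 : R) by move=> ?; rewrite normr1.
apply: (bounded_harmonic_unique (b := b) (c := c) (bdd_absorb_lim c) (bddB one hK)).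
- exact: absorb_lim_harmonic.
- by move=> u ub uc; rewrite (avgB (fun=> 1)) avg_cst voltage_harmonic.
- rewrite absorb_lim_boundary ?eqxx// voltage_b// subrr.
  by rewrite (_ : (b == c) = false)//; apply/eqP.
by rewrite absorb_lim_boundary ?eqxx ?orbT// voltage_c// subr0.
Qed.

(** * From the law of the chain to the hitting probability *)

Section Law.
Variables (d : measure_display) (Omega : measurableType d).
Variables (P : probability Omega R) (X : nat -> Omega -> vertex).
Hypothesis markov : is_markov_chain P (trans a b c R) (start a b c) X.

Let mX t v : measurable [set w | X t w = v].
Proof. by case: markov => h _ _; apply: h. Qed.

Let pr (A : set Omega) : R := fine (P A).

Let prE A : measurable A -> P A = (pr A)%:E.
Proof. by move=> mA; rewrite /pr fineK// fin_num_measure. Qed.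

Let pr_le A B : measurable A -> measurable B -> A `<=` B -> pr A <= pr B.
Proof.
by move=> mA mB AB; rewrite -lee_fin -!prE// le_measure ?inE.
Qed.

Let pr_sum4 (A : set Omega) (B : 'I_4 -> set Omega) : measurable A ->
  (forall i, measurable (B i)) -> trivIset setT B -> (forall i, B i `<=` A) ->
  \sum_(i < 4) pr (B i) <= pr A.
Proof.
move=> mA mB tB BA; rewrite -lee_fin -prE// -sumEFin.
under eq_bigr do rewrite -prE//.
rewrite -measure_bigsetU_ord//; apply: le_measure; rewrite ?inE//.
  exact: bigsetU_measurable.
by elim/big_ind: _ => [|C D CA DA|i _]; [exact: sub0set|rewrite subUset|exact: BA].
Qed.

Definition cylinder t (v : nat -> vertex) : set Omega :=
  [set w | forall s, (s <= t)%N -> X s w = v s].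

Definition first_at (u u' : site) : set Omega :=
  [set w | exists2 t, X t w = Some u & forall s, (s <= t)%N -> X s w <> Some u'].

Let measurable_cylinder t v : measurable (cylinder t v).
Proof.
rewrite (_ : cylinder t v = \bigcap_(s in [set s | (s <= t)%N]) [set w | X s w = v s])//.
by apply: bigcap_measurable => //; exists 0%N.
Qed.

Let measurable_first_at u u' : measurable (first_at u u').
Proof.
rewrite (_ : first_at u u' = \bigcup_t ([set w | X t w = Some u] `&`
    \bigcap_(s in [set s | (s <= t)%N]) ~` [set w | X s w = Some u'])).
  apply: bigcupT_measurable => t; apply: measurableI => //.
  apply: bigcap_measurable; first by exists 0%N.
  by move=> s _; apply: measurableC.
apply/seteqP; split=> w /=; first by case=> t h1 h2; exists t.
by case=> t _ [h1 h2]; exists t.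
Qed.

Lemma hitting_time_lt (u u' : site) :
  [set w | (hitting_time R X (Some u) w < hitting_time R X (Some u') w)%E] =
  first_at u u'.
Proof.
apply/seteqP; split=> w /=.
  case/ereal_inf_lt => _ [t /= ht <-] lt; exists t => // s st hs.
  move: lt; rewrite ltNge => /negP; apply.
  apply: ge_ereal_inf; exists (s%:R)%:E; first by exists s.
  by rewrite lee_fin ler_nat.
case=> t ht h; apply: (@le_lt_trans _ _ (t%:R)%:E).
  by apply: ereal_inf_lbound; exists t.
apply: (@lt_le_trans _ _ (t.+1%:R)%:E); first by rewrite lte_fin ltr_nat.
apply: le_ereal_inf_tmp => _ [s /= hs <-]; rewrite lee_fin ler_nat ltnNge.
by apply/negP => /h.
Qed.

(** Prescribes the position at time [t + 1], so as to split a cylinder according to the next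
    step. *)
Let upd t (v : nat -> vertex) x s := if s == t.+1 then x else v s.

Let cylinder_upd t v x : cylinder t (upd t v x) = cylinder t v.
Proof.
apply/seteqP; split=> w h s st; have := h s st; rewrite /upd;
  by rewrite (_ : (s == t.+1) = false)//; lia.
Qed.

Let cylinder_updS t v x :
  cylinder t.+1 (upd t v x) = cylinder t v `&` [set w | X t.+1 w = x].
Proof.
apply/seteqP; split=> [w h|w [h hx] s]; last first.
  rewrite leq_eqVlt /upd => /orP[/eqP->|]; first by rewrite eqxx.
  by move=> st; rewrite (_ : (s == t.+1) = false); [exact: h|lia].
split; last by have := h t.+1 (leqnn _); rewrite /upd eqxx.
rewrite -(cylinder_upd t v x) => s st; apply: h; exact: leqW.
Qed.

(** The Markov property gives each of the four extensions a quarter of the mass; they are disjoint,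
    so lower bounds on them add up. *)
Lemma cylinder_step (E : set Omega) (g : site -> R) t (v : nat -> vertex) :
  measurable E -> ~~ returning b c (v t) ->
  (forall (i : 'I_4) x, x = origin a (v t) + dir i.+1 ->
    pr (cylinder t.+1 (upd t v (Some x))) * g x <=
    pr (cylinder t.+1 (upd t v (Some x)) `&` E)) ->
  pr (cylinder t v) * avg g (origin a (v t)) <= pr (cylinder t v `&` E).
Proof.
move=> mE nr step.
pose x (i : 'I_4) := origin a (v t) + dir i.+1.
pose B i := cylinder t.+1 (upd t v (Some (x i))) `&` E.
have cylB i : pr (cylinder t.+1 (upd t v (Some (x i)))) = pr (cylinder t v) / 4.
  have [_ _ /(_ t (upd t v (Some (x i))))] := markov.
  rewrite -!/(cylinder _ _) cylinder_upd !prE// -EFinM => -[->].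
  rewrite /upd eqxx (_ : (t == t.+1) = false); last by lia.
  by rewrite /trans (negPf nr) /x dist1_dir eqxx mul1r.
have mB i : measurable (B i) by apply: measurableI.
have tB : trivIset setT B.
  move=> i j _ _ [w [[]]]; rewrite /B !cylinder_updS => -[_ /= ->] _ [[_ /= e] _].
  by move: e => /Some_inj /addrI; apply: dir_inj.
have BA i : B i `<=` cylinder t v `&` E.
  by apply: setSI; rewrite cylinder_updS => w [].
apply: le_trans (pr_sum4 _ mB tB BA); last exact: measurableI.
rewrite /avg mulrA mulrAC mulr_sumr; apply: ler_sum => i _.
by rewrite -(cylB i); apply: (step i).
Qed.

(** Induction on the number of steps. One step is taken before [absorb] is evaluated: if a is split,
    the origin of the start is b or c, where [absorb] would stop at once. *)
Lemma cylinder_first_at (u u' : site) N t (v : nat -> vertex) :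
  ((u == b) && (u' == c)) || ((u == c) && (u' == b)) ->
  (forall s, (s <= t)%N -> ~~ returning b c (v s)) ->
  pr (cylinder t v) * avg (absorb u N) (origin a (v t)) <=
  pr (cylinder t v `&` first_at u u').
Proof.
move=> uu'; elim: N t v => [|N IH] t v nr.
all: apply: cylinder_step; [exact: measurable_first_at|exact: nr|].
all: move=> i x _; set v' := upd t v (Some x).
all: have nr' s : (s <= t)%N -> v' s = v s by rewrite /v' /upd; case: eqP => //; lia.
all: case: (boolP ((x == b) || (x == c))) => xbc.
(* The next site is b or c. It contributes only if it is [u], and then the whole extended cylinder
   lies in [first_at u u']. *)
1,3: rewrite absorb_boundary//; case: eqP => [xu|_].
2,4: by rewrite mulr0 fine_ge0.
1,2: rewrite mulr1; apply: pr_le => //; first exact: measurableI.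
1,2: move=> w cw; split=> //; exists t.+1.
1,3: by rewrite cw// /v' /upd eqxx xu.
1,2: move=> s; rewrite leq_eqVlt => /orP[/eqP->|st] /=.
1,3: rewrite cw// /v' /upd eqxx xu => -[uu].
1,2: by move: uu'; rewrite uu; case/orP => /andP[/eqP e1 /eqP e2]; apply: bc; rewrite -e1 -e2.
1,2: rewrite cw ?leqW// nr'// => e; have := nr _ st; rewrite e /returning.
1,2: by case/orP: uu' => /andP[/eqP _ /eqP ->]; rewrite eqxx ?orbT.
  by rewrite /= (negPf xbc) mulr0 fine_ge0.
rewrite /= (negPf xbc).
have -> : x = origin a (v' t.+1) by rewrite /v' /upd eqxx.
apply: IH => s; rewrite leq_eqVlt => /orP[/eqP->|st].
  by rewrite /v' /upd eqxx /returning.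
by rewrite nr'//; apply: nr.
Qed.

Lemma absorb_le_first_at (u u' : site) N :
  ((u == b) && (u' == c)) || ((u == c) && (u' == b)) ->
  avg (absorb u N) a <= pr (first_at u u').
Proof.
move=> uu'; have := @cylinder_first_at u u' N 0%N (fun=> start a b c) uu'.
rewrite origin_start => h.
have c1 : pr (cylinder 0 (fun=> start a b c)) = 1.
  rewrite /pr (_ : cylinder _ _ = [set w | X 0%N w = start a b c]).
    by case: markov => _ -> _.
  apply/seteqP; split=> w /=; first exact.
  by move=> h0 s; rewrite leqn0 => /eqP->.
rewrite c1 mul1r in h; apply: le_trans (h _) _; first by rewrite returning_start.
by apply: pr_le => //; exact: measurableI.
Qed.

(** Lower bounds suffice: those for [T_b < T_c] and [T_c < T_b] add up to 1 and the events are
    disjoint, so both are equalities. *)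
Lemma hit_before_voltage :
  hit_before P X (Some b) (Some c) = avg (voltage R b c) a.
Proof.
rewrite /hit_before hitting_time_lt -/(pr _).
have lim_le u u' : ((u == b) && (u' == c)) || ((u == c) && (u' == b)) ->
    avg (absorb_lim u) a <= pr (first_at u u').
  move=> uu'; apply: (cvg_le_bound (cvg_avg (@cvg_absorb u))) => N.
  exact: absorb_le_first_at.
have hb := lim_le b c; have hc := lim_le c b.
rewrite !eqxx ?orbT absorb_lim_b in hb; rewrite !eqxx ?orbT absorb_lim_c in hc.
rewrite (avgB (fun=> 1)) avg_cst in hc.
have := hb isT; have := hc isT.
suff : pr (first_at b c) + pr (first_at c b) <= 1 by lra.
rewrite -lee_fin EFinD -!prE// -measureU//; first exact/probability_le1/measurableU.
apply/seteqP; split=> // w [[t ht h] [s hs h']].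
by case: (leqP s t) => [/h|/ltnW /h'].
Qed.

End Law.
End Chain.

(** * The rotor walk *)

Section Rotor.
Variable R : realType.

Lemma polar (p q : R) : 0 < p ^+ 2 + q ^+ 2 ->
  exists th : R, 0 <= th < 2 * pi /\
    exists2 rho : R, 0 < rho & p = rho * cos th /\ q = rho * sin th.
Proof.
move=> pq; pose rho := Num.sqrt (p ^+ 2 + q ^+ 2).
have rho0 : 0 < rho by rewrite sqrtr_gt0.
have rho2 : rho ^+ 2 = p ^+ 2 + q ^+ 2 by rewrite sqr_sqrtr// ltW.
pose u := p / rho; pose v := q / rho.
have pu : p = rho * u by rewrite mulrC divfK// gt_eqF.
have qv : q = rho * v by rewrite mulrC divfK// gt_eqF.
have uv : u ^+ 2 + v ^+ 2 = 1.
  by rewrite !expr_div_n -mulrDl -rho2 divff// gt_eqF// exprn_gt0.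
have u1 : -1 <= u <= 1 by have := sqr_ge0 v => v2; apply/andP; split; nra.
have sinu : sin (acos u) = `|v|.
  by rewrite sin_acos// -sqrtr_sqr; congr Num.sqrt; lra.
have cosu : cos (acos u) = u by rewrite acosK// in_itv.
have a0 := acos_ge0 u1; have api := acos_lepi u1; have pi0 := pi_gt0 R.
have [q0|q0] := leP 0 q.
  exists (acos u); split; first by apply/andP; split; lra.
  exists rho => //; rewrite cosu sinu ger0_norm; first by split.
  by rewrite divr_ge0// ltW.
have v0 : v < 0 by rewrite ltr_pdivrMr ?mul0r.
have u1' : -1 <= u < 1.
  by case/andP: u1 => -> /=; rewrite le_eqVlt => /orP[/eqP e|//]; move: uv; rewrite e; nra.
have a0' := acos_gt0 u1'.
exists (- acos u + pi *+ 2); split; first by apply/andP; split; lra.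
exists rho => //; rewrite cosD2pi sinD2pi cosN sinN cosu sinu ltr0_norm// opprK.
by split.
Qed.

Lemma argP (p q : R) : 0 < p ^+ 2 + q ^+ 2 ->
  0 <= arg p q < 2 * pi /\
  exists2 rho : R, 0 < rho & p = rho * cos (arg p q) /\ q = rho * sin (arg p q).
Proof. by move/polar => /(xgetPex 0). Qed.

(** The sectors cut out by the diagonals through (1/2, 1/2). In each the initial rotor points away
    from the centre, so that the walk tries the outward direction late. *)
Variant rotor_sector (x y : int) : nat -> Prop :=
| RotorEast of y < x & 1 <= x + y : rotor_sector x y 4
| RotorNorth of x <= y & 2 <= x + y : rotor_sector x y 1
| RotorWest of x < y & x + y <= 1 : rotor_sector x y 2
| RotorSouth of y <= x & x + y <= 0 : rotor_sector x y 3.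

(* With psi = arg + pi / 4, the signs of cos psi and sin psi are those of
   x - y and x + y - 1, and the rotor is the number of the quadrant of psi. *)
Lemma rotor_initP (x y : int) : rotor_sector x y (rotor_init R (x, y)).
Proof.
pose p : R := x%:~R - 1 / 2; pose q : R := y%:~R - 1 / 2.
(* Twice an integer is never 1, so the vector whose argument is taken is nonzero. *)
have half_neq0 (z : int) : (z%:~R - 1 / 2 : R) != 0.
  apply/eqP => h; have : (z *+ 2)%:~R = 1%:~R :> R by rewrite rmorphMn /=; lra.
  by move/intr_inj; lia.
have pq : 0 < p ^+ 2 + q ^+ 2.
  by rewrite addr_gt0// exprn_even_gt0//= half_neq0.
have [/andP[th0 th1] [rho rho0 [hp hq]]] := argP pq.
rewrite /rotor_init -/p -/q; set th := arg p q in th0 th1 hp hq *.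
have pi0 := pi_gt0 R.
set z : R := _ + _; have := floor_itv z; set k := Num.floor z => /andP[k1 k2].
rewrite rmorphD /= in k2.
have z1 : 0 <= z by rewrite /z addr_ge0// mulr_ge0// divr_ge0// ltW.
have z2 : z < 5.
  suff : 2 / pi * th < 4 by rewrite /z; lra.
  by rewrite mulrAC ltr_pdivrMr//; lra.
have k0 : (0 <= k) by rewrite floor_ge_int.
have k5 : (k < 5) by rewrite floor_lt_int.
pose s : R := cos (pi / 4).
have s0 : 0 < s by apply: cos_gt0_pihalf; apply/andP; split; lra.
have sE : sin (pi / 4) = s :> R.
  by rewrite -cosBpihalf -cosN /s; congr cos; lra.
(* What remains of psi after [k] quarter turns; it lies in the first quadrant because
   [z = 2 (th + pi / 4) / pi]. *)
pose eta : R := th + pi / 4 - k%:~R * pi / 2.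
have e1 : 0 <= eta.
  have : z * pi = pi / 2 + 2 * th by rewrite /z; field; lra.
  have : k%:~R * pi <= z * pi by rewrite ler_pM2r.
  by rewrite /eta; lra.
have e2 : eta < pi / 2.
  have : z * pi = pi / 2 + 2 * th by rewrite /z; field; lra.
  have : z * pi < (k%:~R + 1) * pi by rewrite ltr_pM2r.
  by rewrite /eta; lra.
have ce : 0 < cos eta by apply: cos_gt0_pihalf; apply/andP; split; lra.
have se : 0 <= sin eta by apply: sin_ge0_pi; apply/andP; split; lra.
have [n kn] : exists n : nat, k = n by exists (absz k); rewrite gez0_abs.
have [cn sn] := dirE R n.
have thE : th + pi / 4 = eta + n%:R * pi / 2 by rewrite /eta kn; lra.
have hc : (x%:~R - y%:~R) * s = rho * (cos eta * (dir n).1%:~R - sin eta * (dir n).2%:~R).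
  rewrite cn sn -cosD -thE cosD -/s sE mulrBr !mulrA.
  have -> : rho * cos th = p by []. have -> : rho * sin th = q by [].
  by rewrite /p /q; lra.
have hs : (x%:~R + y%:~R - 1) * s = rho * (sin eta * (dir n).1%:~R + cos eta * (dir n).2%:~R).
  rewrite cn sn -sinD -thE sinD -/s sE mulrDr !mulrA.
  have -> : rho * cos th = p by []. have -> : rho * sin th = q by [].
  by rewrite /p /q; lra.
have rc : 0 < rho * cos eta by rewrite mulr_gt0.
have rs : 0 <= rho * sin eta by rewrite mulr_ge0// ltW.
have pos (m : int) : 0 < m%:~R * s -> 0 < m by rewrite pmulr_lgt0// ltr0z.
have nneg (m : int) : 0 <= m%:~R * s -> 0 <= m by rewrite pmulr_lge0// ler0z.
have E1 : (x - y)%:~R * s = rho * (cos eta * (dir n).1%:~R - sin eta * (dir n).2%:~R).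
  by rewrite rmorphB.
have E2 : (x + y - 1)%:~R * s = rho * (sin eta * (dir n).1%:~R + cos eta * (dir n).2%:~R).
  by rewrite rmorphB rmorphD.
have E3 : (y - x)%:~R * s = - (rho * (cos eta * (dir n).1%:~R - sin eta * (dir n).2%:~R)).
  by rewrite -E1 !rmorphB /=; lra.
have E4 : (1 - x - y)%:~R * s = - (rho * (sin eta * (dir n).1%:~R + cos eta * (dir n).2%:~R)).
  by rewrite -E2 !rmorphB rmorphD /=; lra.
rewrite kn in k5 *.
(* The eastern sector occurs twice, for [n = 0] and for [n = 4], since [arg] jumps inside it. *)
case: n k5 E1 E2 E3 E4 {kn cn sn thE hc hs} => [|[|[|[|[|n]]]]] // _;
  rewrite /dir /= => E1 E2 E3 E4.
- constructor.
    by move: (pos (x - y) ltac:(rewrite E1; lra)); clear; lia.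
  by move: (nneg (x + y - 1) ltac:(rewrite E2; lra)); clear; lia.
- constructor.
    by move: (nneg (y - x) ltac:(rewrite E3; lra)); clear; lia.
  by move: (pos (x + y - 1) ltac:(rewrite E2; lra)); clear; lia.
- constructor.
    by move: (pos (y - x) ltac:(rewrite E3; lra)); clear; lia.
  by move: (nneg (1 - x - y) ltac:(rewrite E4; lra)); clear; lia.
- constructor.
    by move: (nneg (x - y) ltac:(rewrite E1; lra)); clear; lia.
  by move: (pos (1 - x - y) ltac:(rewrite E4; lra)); clear; lia.
- constructor.
    by move: (pos (x - y) ltac:(rewrite E1; lra)); clear; lia.
  by move: (nneg (x + y - 1) ltac:(rewrite E2; lra)); clear; lia.
Qed.

End Rotor.

(** * Departures, visits and rotors of the walk *)

Section Walk.
Variables (R : realType) (a b c : site).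
Local Notation returning := (returning b c).
Local Notation start := (start a b c).
Local Notation walk := (rotor_walk a b c R).
Local Notation init := (rotor_init R).

Definition state t := iter t (rotor_step a b c) (start, rotor0 a b c R).

Definition out_dir t : nat :=
  let: (x, r) := state t in if (r x < deg b c x)%N then (r x).+1 else 1%N.

Lemma walkS t : walk t.+1 = successor a b c (walk t) (out_dir t).
Proof. by rewrite /rotor_walk /out_dir iterS -/(state t); case: (state t). Qed.

Lemma stateS t v : (state t.+1).2 v =
  if v == walk t then out_dir t else (state t).2 v.
Proof.
by rewrite /rotor_walk /out_dir [state t.+1]iterS -/(state t); case: (state t).
Qed.

Lemma walkS_live t : ~~ returning (walk t) ->
  walk t.+1 = Some (origin a (walk t) + dir (out_dir t)).
Proof. by rewrite walkS /successor => /negPf->. Qed.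

Lemma walkS_returning t : returning (walk t) -> walk t.+1 = start.
Proof. by rewrite walkS /successor => ->. Qed.

(* The vertices that can be reached; [origin a] is injective on those of them
   that are not returning. *)
Definition legal (v : vertex) := (v != None) || (start == None).

Lemma walk_legal t : legal (walk t).
Proof.
case: t => [|t]; first by rewrite /legal /rotor_walk /=; case: eqP.
rewrite walkS /successor /legal; case: ifP => // _.
by case: eqP.
Qed.

Lemma origin_inj v w : legal v -> legal w -> ~~ returning v -> ~~ returning w ->
  origin a v = origin a w -> v = w.
Proof.
rewrite /legal /Defs.start /Defs.returning; case: ifP => [/orP ab|_].
  case: v w => [v|] [w|] //= _ _; first by move=> _ _ ->.
  - by move=> + _ e; rewrite e; case: ab => /eqP->; rewrite eqxx ?orbT.
  - by move=> _ + e; rewrite -e; case: ab => /eqP->; rewrite eqxx ?orbT.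
by case: v w => [v|] [w|] //= _ _ _ _ ->.
Qed.

Definition live t := ~~ returning (walk t).

(** Departures are attributed to the origin, so those of the split copy [None] count at [a];
    passages through b and c are left out. *)
Definition exits t u : nat :=
  \sum_(s < t) (live s && (origin a (walk s) == u)).

Definition exits_dir t u (i : nat) : nat :=
  \sum_(s < t) [&& live s, origin a (walk s) == u & out_dir s == i].

Definition vis t (v : vertex) : nat := \sum_(s < t) (walk s == v).

Lemma exitsS t u : exits t.+1 u =
  (exits t u + (live t && (origin a (walk t) == u)))%N.
Proof. by rewrite /exits big_ord_recr. Qed.

Lemma exits_dirS t u i : exits_dir t.+1 u i =
  (exits_dir t u i + [&& live t, origin a (walk t) == u & out_dir t == i])%N.
Proof. by rewrite /exits_dir big_ord_recr. Qed.

Lemma visS t v : vis t.+1 v = (vis t v + (walk t == v))%N.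
Proof. by rewrite /vis big_ord_recr. Qed.

Lemma init_bounds u : (1 <= init u <= 4)%N.
Proof. by case: u => x y; case: (rotor_initP R x y). Qed.

(** The rotor advances by one at each departure. Residues lie in {1, 2, 3, 4}, whence the shift by
    one, exact as [init >= 1]. *)
Lemma rotorE t v : legal v -> ~~ returning v ->
  (state t).2 v = ((init (origin a v) + exits t (origin a v) - 1) %% 4).+1.
Proof.
move=> lv nv; have := init_bounds (origin a v); elim: t => [|t IH] hb.
  by rewrite /exits big_ord0 /state /= /rotor0 (negPf nv); lia.
rewrite stateS exitsS; case: eqP => [vw|vw].
  have lt : live t by rewrite /live -vw.
  rewrite lt -vw eqxx /= /out_dir; case E : (state t) => [x r].
  have xw : x = v by rewrite vw /rotor_walk -/(state t) E.
  have := IH hb; rewrite E /= xw /deg (negPf nv) => ->.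
  by case: ifP; lia.
rewrite IH// (_ : live t && _ = false) ?addn0//; apply/negP => /andP[lt /eqP e].
by apply: vw; apply: origin_inj => //; exact: walk_legal.
Qed.

Lemma out_dirE t : live t -> out_dir t =
  ((init (origin a (walk t)) + exits t (origin a (walk t))) %% 4).+1.
Proof.
move=> lt; have := rotorE t (walk_legal t) lt.
have := init_bounds (origin a (walk t)); rewrite /out_dir /rotor_walk -/(state t).
case E : (state t) => [x r] hb /= ->.
move: lt; rewrite /live /rotor_walk -/(state t) E /= /deg => /negPf->.
by move: (init _) (exits _ _) hb => m n; clear=> hb; case: ifP => h; lia.
Qed.

(* The exit from u at which direction i is used for the first time. *)
Definition offset u (i : nat) : nat := ((i + 7 - init u) %% 4).+1.

Lemma exits_dirE t u (i : 'I_4) :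
  exits_dir t u i.+1 = ((exits t u + 4 - offset u i.+1) %/ 4)%N.
Proof.
rewrite /offset; have hi := ltn_ord i; have hb := init_bounds u.
elim: t => [|t IH]; first by rewrite /exits_dir /exits !big_ord0; lia.
rewrite exits_dirS exitsS IH.
case: (boolP (live t)) => lt; last by rewrite /= !addn0.
case: eqP => [e|_]; last by rewrite /= !addn0.
rewrite out_dirE// e /=.
move: (exits t u) (init u) (nat_of_ord i) hb hi {IH e} => n r j; clear.
by case: eqP; lia.
Qed.

Lemma out_dir_ord t : live t -> exists i : 'I_4, out_dir t = i.+1.
Proof.
move=> lt; rewrite out_dirE//.
set m := (_ + _)%N.
by exists (Ordinal (ltn_pmod m (isT : (0 < 4)%N))).
Qed.

(** A visit away from the start comes one step after a departure from a neighbour, which explains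
    [t + 1] against [t]. *)
Lemma vis_le_exits_dir t (u : site) : Some u != start ->
  (vis t.+1 (Some u) <= \sum_(i < 4) exits_dir t (u - dir i.+1)%R i.+1)%N.
Proof.
move=> us; elim: t => [|t IH].
  by rewrite /vis big_ord_recr big_ord0 /= /rotor_walk /= eq_sym (negPf us).
rewrite visS; case: eqP => [w|_]; last first.
  rewrite addn0 (leq_trans IH)//; apply: leq_sum => i _.
  by rewrite exits_dirS leq_addr.
case: (boolP (live t)) => lt; last first.
  by move: lt us; rewrite negbK => /walkS_returning; rewrite w => ->; rewrite eqxx.
have [i hi] := out_dir_ord lt.
move: w; rewrite walkS_live// hi => -[] e.
rewrite (bigD1 i)//= exits_dirS lt hi -e addrK !eqxx /= addnAC leq_add2r.
rewrite -[u]e in IH; apply: (leq_trans IH); rewrite (bigD1 i)//= addrK leq_add2l.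
by apply: leq_sum => j _; rewrite exits_dirS leq_addr.
Qed.

Lemma exits_dir_le_vis t u (i : 'I_4) :
  (exits_dir t u i.+1 <= vis t.+1 (Some (u + dir i.+1)%R))%N.
Proof.
elim: t => [|t IH]; first by rewrite /exits_dir big_ord0.
rewrite exits_dirS visS leq_add//; case: and3P => // -[lt /eqP e /eqP o].
by rewrite walkS_live// e o eqxx.
Qed.

Lemma exits_le_vis t u : u != a -> (exits t u <= vis t (Some u))%N.
Proof.
move=> ua; apply: leq_sum => s _; case: andP => // -[_ /eqP].
case: (walk s) => [v|] /=; first by move=> ->; rewrite eqxx.
by move=> e; rewrite e eqxx in ua.
Qed.

Lemma vis_le_exits t u : u != b -> u != c -> (vis t (Some u) <= exits t u)%N.
Proof.
move=> ub uc; apply: leq_sum => s _; case: eqP => // e.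
rewrite /live e eqxx andbT /Defs.returning.
by rewrite !(inj_eq Some_inj) (negPf ub) (negPf uc).
Qed.

Lemma exits_leS t u : (exits t u <= exits t.+1 u)%N.
Proof. by rewrite exitsS leq_addr. Qed.

(* The number of the square annulus around (1/2, 1/2) that contains the site;
   a first passage through an annulus goes round it anticlockwise. *)
Definition layer (u : site) : nat :=
  maxn (minn (absz u.1) (absz (u.1 - 1))) (minn (absz u.2) (absz (u.2 - 1))).

Definition corner (u : site) : bool := (u.1 == u.2) || (u.1 + u.2 == 1).

Lemma layer_step u (i : 'I_4) :
  (layer u <= (layer (u + dir i.+1)%R).+1)%N /\ (layer (u + dir i.+1)%R <= (layer u).+1)%N.
Proof.
case: u => x y; rewrite /layer; case: i => [[|[|[|[|i]]]] hi] //=; lia.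
Qed.

(** The initial rotor points outwards, so this direction comes last in the turn; a corner has two
    outward directions, which come third and fourth. *)
Lemma offset_outward u (i : 'I_4) : layer (u + dir i.+1) = (layer u).+1 ->
  (3 <= offset u i.+1 <= 4)%N /\ (~~ corner u -> offset u i.+1 = 4).
Proof.
case: u => x y; rewrite /layer /corner /offset; case: (rotor_initP R x y);
  case: i => [[|[|[|[|i]]]] hi] //=; lia.
Qed.

Lemma outward_ex v : ~~ corner v ->
  exists i : 'I_4, layer (v - dir i.+1) = (layer v).+1.
Proof.
case: v => x y; rewrite /layer /corner => h.
have [h1|[h1|[h1|h1]]] : (y < x /\ 2 <= x + y) \/ (x < y /\ 2 <= x + y) \/
    (x < y /\ x + y <= 0) \/ (y < x /\ x + y <= 0) by move: h => /=; lia.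
- by exists 1 => /=; lia.
- by exists 2%:R => /=; lia.
- by exists ord_max => /=; lia.
- by exists ord0 => /=; lia.
Qed.

Lemma outward_ex2 v : corner v ->
  exists i j : 'I_4, [/\ i != j, layer (v - dir i.+1) = (layer v).+1
    & layer (v - dir j.+1) = (layer v).+1].
Proof.
case: v => x y; rewrite /layer /corner => h.
have [h1|[h1|[h1|h1]]] : (y = x /\ 1 <= x) \/ (x + y = 1 /\ 1 <= x) \/
    (x + y = 1 /\ x <= 0) \/ (y = x /\ x <= 0) by move: h => /=; lia.
- by exists 1, 2%:R; split => //=; lia.
- by exists 1, ord0; split => //=; lia.
- by exists 2%:R, ord_max; split => //=; lia.
- by exists ord0, ord_max; split => //=; lia.
Qed.

(** * Departures annulus by annulus, and the bound on time *)

Hypothesis bc : b <> c.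

Definition base : nat := maxn (layer a) (maxn (layer b) (layer c)).

Definition quota k u : nat := (k - (layer u - base.+1))%N.

(* With k the number of departures from a, the i-th annulus outside a, b and c
   sees at most 4 (k - i + 1) - 1 departures from each of its sites: a site that
   departs that often has used the outward direction only k - i times, and at
   least one of its four incoming edges comes from the next annulus. *)
Definition exit_bound k u : nat :=
  if (layer u <= base)%N then (4 * k)%N
  else if corner u then (4 * quota k u - 2)%N else (4 * quota k u - 1)%N.

Lemma exit_bound_le k u : (exit_bound k u <= 4 * k)%N.
Proof. by rewrite /exit_bound /quota; case: ifP => // _; case: ifP; lia. Qed.

Lemma exit_bound_mono k k' u : (k <= k')%N -> (exit_bound k u <= exit_bound k' u)%N.
Proof.
by rewrite /exit_bound /quota => kk; case: ifP => [|_]; [lia|case: ifP; lia].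
Qed.

(** An edge from the inner annulus loses one use because outward directions come late, which the 1
    and 2 subtracted in [exit_bound] exploit; from the outer annulus the smaller quota gives the
    extra one. *)
Lemma exits_dir_le_quota k t u (i : 'I_4) : (exits t u <= exit_bound k u)%N ->
  (base < layer (u + dir i.+1)%R)%N ->
  (exits_dir t u i.+1 <= quota k (u + dir i.+1)%R -
     (layer u == (layer (u + dir i.+1)%R).+1))%N.
Proof.
move=> h; rewrite exits_dirE.
have [l1 l2] := layer_step u i; have o := @offset_outward u i.
have o1 : (1 <= offset u i.+1)%N by [].
move: h l1 l2 o; rewrite /exit_bound /quota.
move: (layer (u + dir i.+1)) (layer u) (exits t u) (offset u i.+1) o1.
case: (corner u) => l' l e o o1; case: ifP => lL h l1 l2 hl' hb.
- by lia.
- by case: (eqVneq l' l.+1) => [/hl' [/andP[]]|]; lia.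
- by lia.
by case: (eqVneq l' l.+1) => [/hl' [_ /(_ isT)]|]; lia.
Qed.

Lemma exits_dir_le_departures k t u (i : 'I_4) :
  (exits t u <= exit_bound k u)%N -> (exits_dir t u i.+1 <= k)%N.
Proof.
move=> /leq_trans /(_ (exit_bound_le k u)); rewrite exits_dirE.
by have : (1 <= offset u i.+1)%N by []; lia.
Qed.

Lemma sum4_le (F : 'I_4 -> nat) (m : nat) : (forall i, (F i <= m)%N) ->
  (\sum_(i < 4) F i <= 4 * m)%N.
Proof.
by move=> h; rewrite -[4%N in leqRHS]card_ord -sum_nat_const; apply: leq_sum.
Qed.

Lemma sum4_le1 (F : 'I_4 -> nat) (m : nat) (i : 'I_4) : (forall i, (F i <= m)%N) ->
  (F i <= m - 1)%N -> (\sum_(i < 4) F i <= 4 * m - 1)%N.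
Proof.
move=> h hi; rewrite (bigD1 i)//=.
have c3 : #|[pred k | k != i]| = 3%N.
  by apply: (@addnI 1); rewrite -[RHS](card_ord 4) -(cardC (pred1 i)) card1.
have : (\sum_(k < 4 | k != i) F k <= 3 * m)%N.
  by rewrite -[3%N in leqRHS]c3 -sum_nat_const; apply: leq_sum.
by move=> r; apply: leq_trans (leq_add hi r) _; lia.
Qed.

Lemma sum4_le2 (F : 'I_4 -> nat) (m : nat) (i j : 'I_4) : (forall i, (F i <= m)%N) ->
  i != j -> (F i <= m - 1)%N -> (F j <= m - 1)%N -> (\sum_(i < 4) F i <= 4 * m - 2)%N.
Proof.
move=> h ij hi hj; rewrite (bigD1 i)//= (bigD1 j)/=; last by rewrite eq_sym.
have c2 : #|[pred k | (k != i) && (k != j)]| = 2%N.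
  apply: (@addnI 2); rewrite -[RHS](card_ord 4) -(cardC (pred2 i j)) card2 ij.
  by congr addn; apply: eq_card => x; rewrite !inE negb_or.
have : (\sum_(k < 4 | (k != i) && (k != j)) F k <= 2 * m)%N.
  by rewrite -[2%N in leqRHS]c2 -sum_nat_const; apply: leq_sum.
by move=> r; apply: leq_trans (leq_add hi (leq_add hj r)) _; lia.
Qed.

(** Each incoming edge carries at most the quota, and one less if it comes from the next annulus: at
    least one edge does, two at a corner. *)
Lemma vis_bound k t (u : site) : Some u != start ->
  (forall v, (exits t v <= exit_bound k v)%N) ->
  (vis t.+1 (Some u) <= exit_bound k u)%N.
Proof.
move=> us h; apply: (leq_trans (vis_le_exits_dir t us)).
rewrite /exit_bound; case: ifP => [_|/negbT]; last rewrite -ltnNge => lu.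
  by apply: sum4_le => i; apply: exits_dir_le_departures.
pose m := quota k u.
have E (i : 'I_4) : (exits_dir t (u - dir i.+1)%R i.+1 <=
    m - (layer (u - dir i.+1)%R == (layer u).+1))%N.
  by have := @exits_dir_le_quota k t (u - dir i.+1) i (h _); rewrite subrK => ->.
have E1 (i : 'I_4) : (exits_dir t (u - dir i.+1)%R i.+1 <= m)%N.
  by apply: leq_trans (E i) _; rewrite leq_subr.
have E2 (i : 'I_4) : layer (u - dir i.+1) = (layer u).+1 ->
    (exits_dir t (u - dir i.+1)%R i.+1 <= m - 1)%N.
  by move=> e; have := E i; rewrite e eqxx.
rewrite -/m; case: (boolP (corner u)) => cu.
  have [i [j [ij /E2 hi /E2 hj]]] := outward_ex2 cu.
  exact: sum4_le2 E1 ij hi hj.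
have [i /E2 hi] := outward_ex cu.
exact: sum4_le1 E1 hi.
Qed.

(** Induction on time: departures before [t + 1] are at most visits before [t + 1], which depend
    only on departures before [t]. *)
Lemma exits_bound t u : (exits t u <= exit_bound (exits t a) u)%N.
Proof.
elim: t u => [|t IH] u; first by rewrite /exits big_ord0.
case: (eqVneq u a) => [->|ua].
  by rewrite /exit_bound /base leq_maxl; lia.
apply: leq_trans (exit_bound_mono u (exits_leS t a)).
apply: leq_trans (exits_le_vis _ ua) _.
apply: vis_bound => //; rewrite /Defs.start; case: ifP => // _.
Qed.

(** A site that was left has positive [exit_bound], which limits its layer; a coordinate exceeds the
    layer by at most one. *)
Lemma live_in_box t s : (s < t)%N -> live s ->
  origin a (walk s) \in box (base + exits t a).+1.
Proof.
move=> st ls; have : (0 < exits t (origin a (walk s)))%N.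
  by rewrite /exits (bigD1 (Ordinal st))//= ls eqxx.
move/leq_trans/(_ (exits_bound _ _)); move: (origin a (walk s)) => u.
rewrite mem_box /exit_bound /quota => h.
have : (layer u <= base + exits t a)%N.
  by move: h; case: ifP; [lia|case: ifP; lia].
by rewrite /layer; move: (_ + _)%N; clear; case: u => x y /=; lia.
Qed.

Lemma sum_live_box (V : nmodType) t (F : site -> nat -> V) :
  \sum_(s < t | live s) F (origin a (walk s)) s =
  \sum_(u <- box (base + exits t a).+1)
    \sum_(s < t | live s && (origin a (walk s) == u)) F u s.
Proof.
rewrite (exchange_big_dep (fun s : 'I_t => live s))/=; last by move=> u s _ /andP[].
apply: eq_bigr => s ls; rewrite big_mkcond.
rewrite (bigD1_seq (origin a (walk s))) ?box_uniq ?live_in_box//= eqxx ls.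
rewrite big1 ?addr0// => u; rewrite eq_sym => /negPf->.
by rewrite andbF.
Qed.

Definition returns t : nat := (vis t (Some b) + vis t (Some c))%N.

Lemma time_split t : t = (returns t +
  \sum_(u <- box (base + exits t a).+1) exits t u)%N.
Proof.
have -> : (\sum_(u <- box (base + exits t a).+1) exits t u = \sum_(s < t) live s)%N.
  rewrite [RHS](eq_bigr (fun s : 'I_t => if live s then 1 else 0)%N); last first.
    by move=> s _; case: (live s).
  rewrite -big_mkcond (@sum_live_box nat t (fun _ _ => 1%N)).
  by apply: eq_bigr => u _; rewrite big_mkcond; apply: eq_bigr => s _; case: (_ && _).
rewrite /returns /vis -!big_split /= -[LHS](card_ord t) -sum1_card.
apply: eq_bigr => s _; rewrite /live /Defs.returning.
case: (walk s) => [u|] //=; rewrite !(inj_eq Some_inj).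
case: (eqVneq u b) => [->|]; last by case: (eqVneq u c).
by rewrite (_ : (b == c) = false)//; apply/eqP.
Qed.

Lemma ratio_bound (m n o v x r : nat) (e : bool) : (m <= n)%N -> (o <= 4)%N ->
  ((n + 4 - o) %/ 4 <= v + e)%N -> (v <= x)%N -> (m <= 4 * x + 8 * r.+1)%N.
Proof. by case: e; lia. Qed.

(** Propagation from b by unit steps: about a quarter of the departures from a site lead to a given
    neighbour, so its visits are at most four times those of the neighbour, up to a constant. *)
Lemma vis_le_returns (u : site) : exists C, forall t,
  (vis t (Some u) <= C * (returns t).+1)%N.
Proof.
rewrite -(subrKC b u); elim/site_ind: (u - b) => [|w i [C hC]].
  by exists 1%N => t; rewrite addr0 mul1n /returns; lia.
rewrite addrA; set v := b + w + dir i.+1.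
case: (boolP ((v == b) || (v == c))) => [vbc|/norP[vb vc]].
  by exists 1%N => t; rewrite mul1n /returns; case/orP: vbc => /eqP->; lia.
have [j hj] : exists j : 'I_4, dir j.+1 = - dir i.+1.
  case: i {v vb vc} => [[|[|[|[|i]]]] hi] //.
  - by exists 2%:R. - by exists ord_max.
  - by exists ord0. - by exists 1.
exists (4 * C + 8)%N => t.
have := exits_dir_le_vis t v j; rewrite hj /v addrK -/v visS.
rewrite exits_dirE; have o1 : (1 <= offset v j.+1 <= 4)%N.
  by rewrite /offset; move: (_ + _ - _)%N; clear; lia.
have := vis_le_exits t vb vc; have := hC t.
by rewrite mulnDl -mulnA; case/andP: o1 => _ o4 x y z; apply: ratio_bound y o4 z x.
Qed.

(** Departures from [a] may be those of [None]; they are measured by the visits to a neighbour. *)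
Lemma exits_start_le_returns : exists C, forall t,
  (exits t a <= C * (returns t).+1)%N.
Proof.
have [C hC] := vis_le_returns (a + dir 1).
exists (4 * C + 8)%N => t; have := exits_dir_le_vis t a ord0.
rewrite exits_dirE visS; have o1 : (1 <= offset a 1 <= 4)%N.
  by rewrite /offset; move: (_ + _ - _)%N; clear; lia.
have := hC t; rewrite mulnDl -mulnA; case/andP: o1 => _ o4 x z.
exact: ratio_bound (leqnn _) o4 z x.
Qed.

Lemma growth : exists C, forall t, (0 < returns t)%N ->
  ((base + exits t a).+1 <= C * returns t)%N /\ (t <= C * returns t ^ 3)%N.
Proof.
have [C hC] := exits_start_le_returns.
pose D := (base + 2 * C + 1)%N.
have hD t : (0 < returns t)%N -> ((base + exits t a).+1 <= D * returns t)%N.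
  by move=> n0; have := hC t; rewrite /D; nia.
clearbody D.
(* 36 is [4 * 3 ^ 2]: at most [4 k] departures from each site, with [k <= D n], and a box of side at
   most [3 D n]. *)
exists (D + 36 * D ^ 3 + 1)%N => t n0; split; first by have := hD t n0; nia.
have hN : (\sum_(u <- box (base + exits t a).+1) exits t u <=
    4 * exits t a * ((base + exits t a).+1.*2.+1 ^ 2))%N.
  rewrite -size_box -sum1_size big_distrr /=; apply: leq_sum => u _.
  by rewrite muln1 (leq_trans (exits_bound t u)) ?exit_bound_le.
rewrite {1}(time_split t).
have hr := hD t n0; move: hN hr; move: (\sum_(u <- _) _)%N => S.
move: (returns t) n0 (exits t a) => n n0 k hN hr.
have h1 : (4 * k * ((base + k).+1.*2.+1 ^ 2) <= 4 * (D * n) * ((3 * (D * n)) ^ 2))%N.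
  by apply: leq_mul; [rewrite leq_mul2l; lia|rewrite leq_exp2r//; lia].
have e : (4 * (D * n) * ((3 * (D * n)) ^ 2) = 36 * D ^ 3 * n ^ 3)%N.
  by rewrite !expnMn; lia.
have n3 : (n <= n ^ 3)%N by rewrite -{1}(expn1 n) leq_pexp2l.
have SD : (S <= 36 * D ^ 3 * n ^ 3)%N by rewrite -e; apply: leq_trans hN h1.
rewrite 2!mulnDl mul1n; move: n3 SD; clear.
by move: (n ^ 3)%N (36 * D ^ 3 * _)%N (D * _)%N => x y z; lia.
Qed.

(** * The voltage along the walk *)

Lemma visits_vis t (v : site) : visits a b c R t v = vis t (Some v).
Proof.
rewrite /visits -sum1_card big_mkcond; apply: eq_bigr => s _.
by rewrite inE; case: (_ == _).
Qed.

Let h := voltage R b c.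

(** The split copy receives the average, since [h a] is then 1 or 0; every vertex other than b and c
    thereby satisfies the mean value property. *)
Definition vertex_voltage (v : vertex) : R := if v is Some u then h u else avg h a.

Lemma vertex_voltage_origin v : ~~ returning v ->
  vertex_voltage v = avg h (origin a v).
Proof.
case: v => [u|] //= /norP[]; rewrite !(inj_eq Some_inj) => ub uc.
by rewrite voltage_harmonic.
Qed.

Lemma vertex_voltage_start : vertex_voltage start = avg h a.
Proof. by rewrite vertex_voltage_origin ?returning_start// origin_start. Qed.

Lemma exits_dir_sum t (u : site) (F : nat -> R) :
  \sum_(s < t | live s && (origin a (walk s) == u)) F (out_dir s) =
  \sum_(i < 4) (exits_dir t u i.+1)%:R * F i.+1.
Proof.
under [RHS]eq_bigr do rewrite /exits_dir natr_sum mulr_suml.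
rewrite exchange_big big_mkcond /=; apply: eq_bigr => s _.
case: (boolP (live s)) => ls /=; last by rewrite big1// => i _; rewrite mul0r.
case: eqP => _ /=; last by rewrite big1// => i _; rewrite mul0r.
have [i ->] := out_dir_ord ls.
rewrite (bigD1 i)//= eqxx mul1r big1 ?addr0// => j ji.
by rewrite eqSS (_ : (_ == _ :> nat) = false) ?mul0r// eq_sym; apply/negbTE.
Qed.

(* The four directions out of u are used almost equally often, and the
   increments [h (u + dir i) - avg h u] add up to zero. *)
Lemma exits_dir_sum_bound t (u : site) :
  `|\sum_(i < 4) (exits_dir t u i.+1)%:R * (h (u + dir i.+1) - avg h u)|
  <= 2 * \sum_(i < 4) `|h (u + dir i.+1) - h u|.
Proof.
pose d i := h (u + dir i) - avg h u; pose g i := `|h (u + dir i) - h u|.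
have d0 : \sum_(i < 4) d i.+1 = 0.
  rewrite sumrB sumr_const card_ord -mulr_natr.
  by rewrite /avg divfK ?subrr// pnatr_eq0.
pose q := (exits t u %/ 4)%N.
have E (i : 'I_4) : exists e : bool, exits_dir t u i.+1 = (q + e)%N.
  rewrite exits_dirE /q /offset; move: (exits t u) (_ + 7 - _)%N => m p.
  have [h1|h1] : ((m + 4 - (p %% 4).+1) %/ 4 = m %/ 4 + 1)%N \/
    ((m + 4 - (p %% 4).+1) %/ 4 = m %/ 4 + 0)%N by clear; lia.
  - by exists true.
  - by exists false.
have -> : \sum_(i < 4) (exits_dir t u i.+1)%:R * d i.+1 =
    \sum_(i < 4) (exits_dir t u i.+1 - q)%:R * d i.+1.
  apply/eqP; rewrite -subr_eq0 -sumrB.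
  rewrite (eq_bigr (fun i : 'I_4 => q%:R * d i.+1)) -?mulr_sumr ?d0 ?mulr0//.
  by move=> i _; have [e ->] := E i; rewrite addKn natrD -mulrBl addrK.
apply: le_trans (ler_norm_sum _ _ _) _.
have gd (i : 'I_4) : `|d i.+1| <= g i.+1 + (\sum_(j < 4) g j.+1) / 4.
  have -> : d i.+1 = (h (u + dir i.+1) - h u) - (\sum_(j < 4) (h (u + dir j.+1) - h u)) / 4.
    by rewrite sumrB sumr_const card_ord /d /avg -mulr_natr; lra.
  apply: le_trans (ler_normB _ _) _; rewrite lerD2l normrM [X in _ * X]ger0_norm//.
  by rewrite ler_pM2r ?invr_gt0//; apply: ler_norm_sum.
apply: (@le_trans _ _ (\sum_(i < 4) (g i.+1 + (\sum_(j < 4) g j.+1) / 4))).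
  apply: ler_sum => i _; apply: le_trans (gd i); have [e ->] := E i.
  by rewrite addKn normrM normr_nat ler_piMl//; case: e.
by rewrite big_split sumr_const card_ord /=; lra.
Qed.

(** Telescoping along the walk: a passage through b or c changes the voltage by [avg h a - 1] or
    [avg h a], and the remaining steps are grouped by site. *)
Lemma voltage_sum t :
  vertex_voltage (walk t) - avg h a =
  (returns t)%:R * avg h a - (vis t (Some b))%:R +
  \sum_(u <- box (base + exits t a).+1)
    \sum_(i < 4) (exits_dir t u i.+1)%:R * (h (u + dir i.+1) - avg h u).
Proof.
rewrite -{1}vertex_voltage_start -[start]/(walk 0).
rewrite -(telescope_sumr (fun s => vertex_voltage (walk s)) (leq0n t)) big_mkord.
rewrite (bigID (fun s : 'I_t => live s))/= addrC; congr (_ + _).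
  rewrite /returns natrD /vis !natr_sum !mulrDl !mulr_suml.
  rewrite -addrA [X in _ + X]addrC addrA -sumrB -big_split big_mkcond /=.
  apply: eq_bigr => s _; rewrite /live.
  case: ifP => [/negbNE ret|/negbFE].
    rewrite walkS_returning// vertex_voltage_start.
    case/orP: (ret) => /eqP-> /=; rewrite !(inj_eq Some_inj) eqxx.
      rewrite /h voltage_b// (_ : (b == c) = false); last exact/eqP.
      by rewrite mul1r mul0r addr0.
    rewrite /h voltage_c// (_ : (c == b) = false); last by apply/eqP => /esym.
    by rewrite mul1r mul0r mulr0n; lra.
  by rewrite /Defs.returning => /norP[/negPf-> /negPf->]; rewrite !mul0r mulr0n subrr addr0.
rewrite -(eq_bigr _ (fun u _ => exits_dir_sum t u (fun i => h (u + dir i) - avg h u))).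
rewrite -(@sum_live_box R t (fun u s => h (u + dir (out_dir s)) - avg h u)).
apply: eq_bigr => s ls; rewrite walkS_live// [X in _ - X]vertex_voltage_origin//.
Qed.

End Walk.

(** * Discrepancy and time bounds from the voltage sum and the box radius *)

Theorem theorem5 (R : realType) (a b c : site) (hbc : b <> c) :
  exists C C' : R,
    forall t : nat,
      let nb := visits a b c R t b in
      let nc := visits a b c R t c in
      let n := (nb + nc)%N in
      ((2 <= n)%N ->
        forall (d : measure_display) (Omega : measurableType d)
          (P : probability Omega R) (X : nat -> Omega -> vertex),
          is_markov_chain P (trans a b c R) (start a b c) X ->
          `| hit_before P X (Some b) (Some c) - nb%:R / n%:R |
            <= C * ln n%:R / n%:R) /\
      ((1 <= n)%N -> t%:R <= C' * n%:R ^+ 3).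
Proof.
have [D hD] := growth R a hbc.
have [K hK] := voltage_bounded R hbc.
have [G G0 hG] := voltage_gradient R hbc.
have K0 : 0 <= K by apply: le_trans (hK 0).
pose M : R := 2 * K + 2 * (G * (2 + 2 * ln (3 * D.+1)%:R)).
have ln2 : 0 < ln 2 :> R by rewrite ln_gt0// ltr1n.
(* The total error is [M + 4 G ln n]; for [n >= 2] the constant [M] is absorbed by
   [ln n >= ln 2]. *)
exists (M / ln 2 + 4 * G), D%:R => t nb nc n.
have nE : n = returns R a b c t by rewrite /n /nb /nc !visits_vis.
split=> [n2 d Omega P X mX|n1]; last first.
  by rewrite -natrX -natrM ler_nat nE; apply: (hD t _).2; rewrite -nE.
have n0 : 0 < n%:R :> R by rewrite ltr0n; lia.
have lnn : ln 2 <= ln n%:R :> R by rewrite ler_ln ?posrE// ler_nat.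
rewrite (hit_before_voltage hbc mX).
set hs := avg _ a.
have -> : hs - nb%:R / n%:R = (n%:R * hs - nb%:R) / n%:R :> R.
  by rewrite mulrBl [n%:R * hs]mulrC mulfK// gt_eqF.
rewrite normrM normfV (gtr0_norm n0) ler_pM2r ?invr_gt0//.
have [|r_le _] := hD t; first by rewrite -nE; apply: ltn_trans n2.
set r := (_ + _).+1 in r_le.
have hsum := @voltage_sum R a b c hbc t; rewrite -/hs -nE -visits_vis -/nb -/r in hsum.
set S := \sum_(u <- _) _ in hsum.
have hS : `|S| <= 2 * (G * (2 + ln (r.*2.+1 ^ 2)%:R)).
  apply: le_trans (ler_norm_sum _ _ _) _.
  have := hG (box r) (r.*2.+1 ^ 2).-1 (box_uniq r).
  rewrite size_box prednK ?expn_gt0// => /(_ (leqnn _)).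
  rewrite -(ler_pM2l (x := 2))// mulr_sumr; apply: le_trans.
  by apply: ler_sum => u _; apply: exits_dir_sum_bound.
have hln : ln (r.*2.+1 ^ 2)%:R <= 2 * ln (3 * D.+1)%:R + 2 * ln n%:R :> R.
  rewrite natrX lnXn ?ltr0n// -mulrDr -[X in X <= _]mulr_natl ler_pM2l//.
  rewrite -lnM ?posrE ?ltr0n//; last exact: ltn_trans n2.
  by rewrite -natrM ler_ln ?posrE ?ltr0n// ?muln_gt0 ?ler_nat ?nE//; nia.
have hv : `|vertex_voltage R a b c (rotor_walk a b c R t) - hs| <= 2 * K.
  have hsK : `|hs| <= K by apply: bdd_avg.
  apply: le_trans (ler_normB _ _) _; rewrite mulrDl mul1r lerD//.
  by case: rotor_walk => [u|] //=.
rewrite (_ : n%:R * hs - nb%:R =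
    (vertex_voltage R a b c (rotor_walk a b c R t) - hs) - S); last first.
  by rewrite hsum addrK.
apply: le_trans (ler_normB _ _) _.
have lnD : 0 <= ln (3 * D.+1)%:R :> R by rewrite ln_ge0// ler1n.
have M0 : 0 <= M by rewrite /M addr_ge0 ?mulr_ge0// addr_ge0// mulr_ge0.
have h1 : M <= M / ln 2 * ln n%:R.
  by rewrite mulrAC ler_pdivlMr// ler_wpM2l.
have h2 : G * ln (r.*2.+1 ^ 2)%:R <= G * (2 * ln (3 * D.+1)%:R + 2 * ln n%:R).
  by rewrite ler_wpM2l.
move: h1 h2 hv hS; rewrite /M; lra.
Qed.
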